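(* Let $h$ be a quasi-homogeneous polynomial of degree $\delta$ on $\mathbb C^2$ (with respect to $R=p_1x\partial_x+p_2y\partial_y$) with an isolated singularity at $0$, let $S=\{h=0\}$, $X_0=\delta^{-1}(h_y\partial_x-h_x\partial_y)$, $\omega_0=\delta^{-1}dh/h$, and let $a_1=1,\dots,a_\mu$ be elements whose classes form a basis of $\mathcal O_2/(h_x,h_y)$. Then the relative logarithmic cohomology module $\widehat H^1_{DR}(\log S)$ is the $\mathbb C[[h]]$-module dual (under $\sharp$) to the module $G_K^1$ of prenormal forms of foliations: $$\widehat H^1_{DR}(\log S)=\mathrm{Coker}(X_0)\cdot\omega_R .$$ In particular, it is a free $\mathbb C[[h]]$-module of rank $\mu$, generated by the forms $a_i\omega_R$, $i=1,\dots,\mu$.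
   Context: $p_1,p_2$ are relatively prime positive integers and $R(h)=\delta h$. $\mathcal O_2=\mathbb C\{x,y\}$, $\widehat{\mathcal O}_2=\mathbb C[[x,y]]$. $\widehat\chi(\log S)$ is the module of formal vector fields $X$ with $X(h)\in(h)$; $\widehat\Omega^q(\log S)$ is the $\widehat{\mathcal O}_2$-module of formal $q$-forms $\omega$ with poles on $S$ such that $h\omega$ and $h\,d\omega$ have no poles. With $\Omega=dx\wedge dy/h$, the map $X\mapsto X^\sharp=i_X\Omega$ is an isomorphism $\widehat\chi(\log S)\to\widehat\Omega^1(\log S)$; ''dual'' refers to this isomorphism. One has $X_0^\sharp=\omega_0$, and $\omega_R:=R^\sharp$. The complex of formal logarithmic forms relative to $\omega_0$ is $\widehat\Omega^{\cdot}_{DR}(\log S)=\widehat\Omega^{\cdot}(\log S)/\big(\omega_0\wedge\widehat\Omega^{\cdot-1}(\log S)\big)$ with the differential induced by $d$. Its first cohomology is $\widehat H^1_{DR}(\log S)=\widehat\Omega^1(\log S)/\widehat B^1_{DR}(\log S)$, where $\widehat B^1_{DR}(\log S)=\{df+g\,\omega_0: f,g\in\widehat{\mathcal O}_2\}$ (all relative 2-forms vanish). $G_K^1=\widehat\chi(\log S)/A_K^1$, with $A_K^1=\{[X_0,Z]:Z\in\widehat\chi(\log S)\}+\widehat{\mathcal O}_2X_0$. $\mathrm{Coker}(X_0)=\widehat{\mathcal O}_2/X_0(\widehat{\mathcal O}_2)$, and the displayed equality is the isomorphism of $\mathbb C[[h]]$-modules sending the class of $a\omega_0+b\omega_R$ to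 the class of $b$. *)

(* Defs.v *)
From HB Require Import structures.
From mathcomp Require Import all_boot all_order all_algebra.
From mathcomp Require Import ring_quotient generic_quotient fraction polyXY.
From mathcomp Require Import boolp reals complex.
From mathcomp Require Import ring.

Set Implicit Arguments.
Unset Strict Implicit.
Unset Printing Implicit Defensive.

Import Order.TTheory GRing.Theory Num.Theory.

Local Open Scope ring_scope.
Local Open Scope complex_scope.
Local Open Scope quotient_scope.

(* Restriction of scalars along f. *)
Definition restr (A B : nzRingType) (f : {rmorphism A -> B}) (V : lmodType B)
  : Type := V.

Section Restriction.
Variables (A B : nzRingType) (f : {rmorphism A -> B}) (V : lmodType B).

HB.instance Definition _ := GRing.Zmodule.on (restr f V).

Definition restr_scale (a : A) (v : restr f V) : restr f V := f a *: (v : V).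

Fact restr_scaleA a b v :
  restr_scale a (restr_scale b v) = restr_scale (a * b) v.
Proof. by rewrite /restr_scale scalerA rmorphM. Qed.
Fact restr_scale1 : left_id 1 restr_scale.
Proof. by move=> v; rewrite /restr_scale rmorph1 scale1r. Qed.
Fact restr_scaleDr : right_distributive restr_scale +%R.
Proof. by move=> a u v; rewrite /restr_scale scalerDr. Qed.
Fact restr_scaleDl v : {morph restr_scale^~ v : a b / a + b}.
Proof. by move=> a b; rewrite /restr_scale rmorphD scalerDl. Qed.

HB.instance Definition _ := GRing.Zmodule_isLmodule.Build A (restr f V)
  restr_scaleA restr_scale1 restr_scaleDr restr_scaleDl.
End Restriction.

Definition submod (A : nzRingType) (V : lmodType A) (S : submodClosed V) : Type :=
  {v : V | v \in S}.

Section Submodule.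
Variables (A : nzRingType) (V : lmodType A) (S : submodClosed V).
HB.instance Definition _ := SubChoice.on (submod S).
HB.instance Definition _ := [SubChoice_isSubLmodule of submod S by <:].
Lemma submod_valP (a : A) (u v : submod S) : val (a *: u + v) = a *: val u + val v.
Proof. by []. Qed.
End Submodule.

(* The structure submodClosed does not provide closure under opposite, which
   Quotient.quot expects. *)
Definition subgroup_of (A : nzRingType) (V : lmodType A) (S : submodClosed V) :
  {pred V} := fun v => v \in S.

Section SubgroupOf.
Variables (A : nzRingType) (V : lmodType A) (S : submodClosed V).
Fact subgroup_of_closed : zmod_closed (subgroup_of S).
Proof.
split=> [|u v uS vS]; first exact: (rpred0 S).
by rewrite /subgroup_of unfold_in -scaleN1r rpredD ?rpredZ.
Qed.
HB.instance Definition _ :=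
  GRing.isZmodClosed.Build V (subgroup_of S) subgroup_of_closed.
End SubgroupOf.

Definition quomod (A : nzRingType) (V : lmodType A) (S : submodClosed V) : Type :=
  Quotient.quot (subgroup_of S).

Section QuotientModule.
Variables (A : nzRingType) (V : lmodType A) (S : submodClosed V).
HB.instance Definition _ := GRing.Zmodule.on (quomod S).

Definition quoclass (v : V) : quomod S := \pi_(Quotient.quot (subgroup_of S)) v.

Lemma quoclassP u v : reflect (quoclass u = quoclass v) (u - v \in S).
Proof.
by rewrite -[_ \in S]/(_ \in subgroup_of S) Quotient.idealrBE; apply: eqP.
Qed.

Fact quoclass_is_zmod_morphism : zmod_morphism quoclass.
Proof. exact: (raddfB (\pi_(Quotient.quot (subgroup_of S)))). Qed.
HB.instance Definition _ :=
  GRing.isZmodMorphism.Build V (quomod S) quoclass quoclass_is_zmod_morphism.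

Definition quomod_scale (a : A) (c : quomod S) : quomod S :=
  quoclass (a *: repr (c : Quotient.quot (subgroup_of S))).

Lemma quomod_scaleE a v : quomod_scale a (quoclass v) = quoclass (a *: v).
Proof.
apply/quoclassP; rewrite -scalerBr; apply: rpredZ.
by apply/quoclassP; rewrite /quoclass reprK.
Qed.

Lemma quoclass_surj (c : quomod S) : exists v, c = quoclass v.
Proof. by exists (repr (c : Quotient.quot (subgroup_of S))); rewrite /quoclass reprK. Qed.

Fact quomod_scaleA a b v :
  quomod_scale a (quomod_scale b v) = quomod_scale (a * b) v.
Proof. by have [w ->] := quoclass_surj v; rewrite !quomod_scaleE scalerA. Qed.
Fact quomod_scale1 : left_id 1 quomod_scale.
Proof.
by move=> v; have [w ->] := quoclass_surj v; rewrite quomod_scaleE scale1r.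
Qed.
Fact quomod_scaleDr : right_distributive quomod_scale +%R.
Proof.
move=> a u v; have [x ->] := quoclass_surj u; have [y ->] := quoclass_surj v.
by rewrite -raddfD !quomod_scaleE scalerDr raddfD.
Qed.
Fact quomod_scaleDl v : {morph quomod_scale^~ v : a b / a + b}.
Proof.
move=> a b; have [w ->] := quoclass_surj v.
by rewrite !quomod_scaleE scalerDl raddfD.
Qed.
HB.instance Definition _ := GRing.Zmodule_isLmodule.Build A (quomod S)
  quomod_scaleA quomod_scale1 quomod_scaleDr quomod_scaleDl.
End QuotientModule.

Arguments quoclass {A V} S v.

Definition is_basis (A : nzRingType) (V : lmodType A) (n : nat) (e : 'I_n -> V) :=
  forall v, exists! c : {ffun 'I_n -> A}, v = \sum_i c i *: e i.
Record fps (A : Type) := Fps { coeffs :> nat -> A }.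

Lemma fpsP (A : Type) (f g : fps A) : f =1 g -> f = g.
Proof. by case: f g => [f] [g] /= /funext ->. Qed.

HB.instance Definition _ (A : Type) := gen_eqMixin (fps A).
HB.instance Definition _ (A : Type) := gen_choiceMixin (fps A).

Section FpsRing.
Variable A : comNzRingType.
Implicit Types (f g k : fps A) (p q r : {poly A}).

Definition fps_opp f : fps A := Fps (fun n => - f n).
Definition fps_add f g : fps A := Fps (fun n => f n + g n).
Definition fps_mul f g : fps A := Fps (fun n => \sum_(i < n.+1) f i * g (n - i)%N).
Definition fpsC (c : A) : fps A := Fps (fun n => if n == 0%N then c else 0).
Definition truncation n f : {poly A} := \poly_(i < n.+1) f i.

Fact fps_addA : associative fps_add.
Proof. by move=> f g k; apply: fpsP => n; exact: addrA. Qed.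
Fact fps_addC : commutative fps_add.
Proof. by move=> f g; apply: fpsP => n; exact: addrC. Qed.
Fact fps_add0 : left_id (fpsC 0) fps_add.
Proof. by move=> f; apply: fpsP => n /=; rewrite if_same add0r. Qed.
Fact fps_addN : left_inverse (fpsC 0) fps_opp fps_add.
Proof. by move=> f; apply: fpsP => n /=; rewrite if_same addNr. Qed.

HB.instance Definition _ :=
  GRing.isZmodule.Build (fps A) fps_addA fps_addC fps_add0 fps_addN.

Lemma coef_truncation m n f : (m <= n)%N -> (truncation n f)`_m = f m.
Proof. by move=> mn; rewrite coef_poly ltnS mn. Qed.

Lemma coef_mul_congr n p q r (s : {poly A}) :
  (forall i, (i <= n)%N -> p`_i = q`_i) ->
  (forall i, (i <= n)%N -> r`_i = s`_i) -> (p * r)`_n = (q * s)`_n.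
Proof.
move=> pq rs; rewrite !coefM; apply: eq_bigr => i _.
by rewrite pq ?rs ?leq_subr // -ltnS.
Qed.

Lemma fps_mulE m n f g : (m <= n)%N ->
  fps_mul f g m = (truncation n f * truncation n g)`_m.
Proof.
move=> mn; rewrite coefM; apply: eq_bigr => i _.
have im : (i <= m)%N by rewrite -ltnS.
by rewrite !coef_truncation ?(leq_trans _ mn) ?leq_subr.
Qed.

Fact fps_mulA : associative fps_mul.
Proof.
move=> f g k; apply: fpsP => n; rewrite !(fps_mulE _ _ (leqnn n)).
rewrite (@coef_mul_congr n _ (truncation n f) _ (truncation n g * truncation n k)) //.
  rewrite mulrA; apply: coef_mul_congr => // i im.
  by rewrite coef_truncation // (fps_mulE _ _ im).
by move=> i im; rewrite coef_truncation // (fps_mulE _ _ im).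
Qed.
Fact fps_mulC : commutative fps_mul.
Proof. by move=> f g; apply: fpsP => n; rewrite !(fps_mulE _ _ (leqnn n)) mulrC. Qed.
Fact fps_mul1 : left_id (fpsC 1) fps_mul.
Proof.
move=> f; apply: fpsP => n /=; rewrite big_ord_recl /= mul1r subn0 big1 ?addr0 //.
by move=> i _; rewrite mul0r.
Qed.
Fact fps_mulDl : left_distributive fps_mul +%R.
Proof.
move=> f g k; apply: fpsP => n /=; rewrite -[RHS]big_split.
by apply: eq_bigr => i _; rewrite mulrDl.
Qed.
Fact fps_1neq0 : fpsC 1 != 0.
Proof.
apply/eqP => /(congr1 (fun f : fps A => f 0%N)) /= /eqP.
by rewrite oner_eq0.
Qed.

HB.instance Definition _ := GRing.Zmodule_isComNzRing.Build (fps A)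
  fps_mulA fps_mulC fps_mul1 fps_mulDl fps_1neq0.

Lemma coeffsD f g n : (f + g) n = f n + g n. Proof. by []. Qed.
Lemma coeffsN f n : (- f) n = - f n. Proof. by []. Qed.
Lemma coeffs0 n : (0 : fps A) n = 0. Proof. by rewrite /= if_same. Qed.
Lemma coeffsM f g n : (f * g) n = \sum_(i < n.+1) f i * g (n - i)%N.
Proof. by []. Qed.
Lemma coeffs_sum I (r : seq I) P (F : I -> fps A) n :
  (\sum_(i <- r | P i) F i) n = \sum_(i <- r | P i) F i n.
Proof. exact: (big_morph (fun f : fps A => f n) (fun f g => coeffsD f g n) (coeffs0 n)). Qed.
Lemma coeffsMn f m n : (f *+ m) n = f n *+ m.
Proof. by elim: m => [|m IH]; rewrite ?mulr0n ?coeffs0 // !mulrS coeffsD IH. Qed.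

Fact fpsC_is_zmod_morphism : zmod_morphism fpsC.
Proof. by move=> a b; apply: fpsP => -[|n] //=; rewrite subr0. Qed.
Fact fpsC_is_monoid_morphism : monoid_morphism fpsC.
Proof.
split=> // a b; apply: fpsP => n; rewrite coeffsM big_ord_recl subn0 big1 ?addr0 /=.
  by case: n => //=; rewrite mulr0.
by move=> i _; rewrite mul0r.
Qed.
HB.instance Definition _ :=
  GRing.isZmodMorphism.Build A (fps A) fpsC fpsC_is_zmod_morphism.
HB.instance Definition _ :=
  GRing.isMonoidMorphism.Build A (fps A) fpsC fpsC_is_monoid_morphism.

Definition fps_deriv f : fps A := Fps (fun n => f n.+1 *+ n.+1).

Fact fps_deriv_is_zmod_morphism : zmod_morphism fps_deriv.
Proof. by move=> f g; apply: fpsP => n; rewrite /= mulrnBl. Qed.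
HB.instance Definition _ :=
  GRing.isZmodMorphism.Build (fps A) (fps A) fps_deriv fps_deriv_is_zmod_morphism.

Lemma fps_derivM f g : fps_deriv (f * g) = fps_deriv f * g + f * fps_deriv g.
Proof.
apply: fpsP => n.
have trD k : forall i, (i <= n)%N ->
    (truncation n (fps_deriv k))`_i = ((truncation n.+1 k)^`())`_i.
  by move=> i ni; rewrite coef_truncation // coef_deriv coef_truncation.
have trE k : forall i, (i <= n)%N -> (truncation n k)`_i = (truncation n.+1 k)`_i.
  by move=> i ni; rewrite !coef_truncation // ltnW.
rewrite coeffsD -[LHS]/(fps_mul f g n.+1 *+ n.+1) (fps_mulE _ _ (leqnn n.+1)) -coef_deriv derivM coefD.
congr (_ + _); rewrite [RHS](fps_mulE _ _ (leqnn n)); apply: coef_mul_congr => i ni.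
- by rewrite trD.
- by rewrite trE.
- by rewrite trE.
- by rewrite trD.
Qed.

Definition fps_unit : pred (fps A) := fun f => `[< exists g, g * f = 1 >].
Definition fps_inv f : fps A :=
  if pselect (exists g, g * f = 1) is left fu then projT1 (cid fu) else f.

Fact fps_mulVr : {in fps_unit, left_inverse 1 fps_inv *%R}.
Proof.
move=> f /asboolP fu; rewrite /fps_inv; case: pselect => // fu'.
exact: projT2 (cid fu').
Qed.
Fact fps_unitP f g : g * f = 1 -> fps_unit f.
Proof. by move=> gf; apply/asboolP; exists g. Qed.
Fact fps_invr_out : {in [predC fps_unit], fps_inv =1 id}.
Proof. by move=> f /asboolP fu; rewrite /fps_inv; case: pselect. Qed.
HB.instance Definition _ :=
  GRing.ComNzRing_hasMulInverse.Build (fps A) fps_mulVr fps_unitP fps_invr_out.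
End FpsRing.

Definition fps_map (A B : Type) (phi : A -> B) (f : fps A) : fps B :=
  Fps (fun n => phi (f n)).

Fact fps_idomain (A : idomainType) : GRing.integral_domain_axiom (fps A).
Proof.
move=> f g fg0; apply: contrapT => /negP; rewrite negb_or => /andP[f0 g0].
have nz (k : fps A) : k != 0 -> exists n, k n != 0.
  move=> k0; apply: contrapT => kn; case/eqP: k0; apply: fpsP => n.
  rewrite coeffs0; apply/eqP; apply: contrapT => /negP kn0; apply: kn; by exists n.
case: (ex_minnP (nz _ f0)) => m fm minf; case: (ex_minnP (nz _ g0)) => n gn ming.
have /(congr1 (fun f : fps A => f (m + n)%N)) := fg0.
rewrite coeffsM coeffs0 => /eqP; apply/negP.
have mlt : (m < (m + n).+1)%N by rewrite ltnS leq_addr.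
rewrite (bigD1 (Ordinal mlt)) //= addKn big1 ?addr0 ?mulf_neq0 // => i im.
have [ltim|gtim|eim] := ltngtP i m.
- have [->|/minf] := eqVneq (f i) 0; first by rewrite mul0r.
  by rewrite leqNgt ltim.
- have [->|/ming] := eqVneq (g (m + n - i)%N) 0; first by rewrite mulr0.
  rewrite leqNgt ltn_subLR ?ltn_add2r ?gtim //.
  by rewrite -ltnS.
- by case/eqP: im; apply: val_inj.
Qed.
HB.instance Definition _ (A : idomainType) :=
  GRing.ComUnitRing_isIntegral.Build (fps A) (@fps_idomain A).

Section Bivariate.
Variable A : comNzRingType.
(* Formal power series in x, y: f i j is the coefficient of x^i y^j. *)
Local Notation hatO := (fps (fps A)).
Implicit Types (f g u v : hatO) (p q : {poly A}) (phi psi : fps A).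

Definition cst (c : A) : hatO := fpsC (fpsC c).
Fact cst_is_zmod_morphism : zmod_morphism cst.
Proof. by move=> a b; rewrite /cst !rmorphB. Qed.
Fact cst_is_monoid_morphism : monoid_morphism cst.
Proof. by split=> [|a b]; rewrite /cst ?rmorph1 ?rmorphM. Qed.
HB.instance Definition _ :=
  GRing.isZmodMorphism.Build A hatO cst cst_is_zmod_morphism.
HB.instance Definition _ :=
  GRing.isMonoidMorphism.Build A hatO cst cst_is_monoid_morphism.

Definition dx f : hatO := fps_deriv f.
Definition dy f : hatO := fps_map (@fps_deriv A) f.

Fact dx_is_zmod_morphism : zmod_morphism dx.
Proof. exact: raddfB. Qed.
Fact dy_is_zmod_morphism : zmod_morphism dy.
Proof. by move=> f g; apply: fpsP => i; rewrite /= raddfB. Qed.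
HB.instance Definition _ :=
  GRing.isZmodMorphism.Build hatO hatO dx dx_is_zmod_morphism.
HB.instance Definition _ :=
  GRing.isZmodMorphism.Build hatO hatO dy dy_is_zmod_morphism.

Lemma dxD f g : dx (f + g) = dx f + dx g. Proof. exact: (raddfD dx). Qed.
Lemma dyD f g : dy (f + g) = dy f + dy g. Proof. exact: (raddfD dy). Qed.
Lemma dxM f g : dx (f * g) = dx f * g + f * dx g.
Proof. exact: fps_derivM. Qed.
Lemma dyM f g : dy (f * g) = dy f * g + f * dy g.
Proof.
apply: fpsP => i; rewrite coeffsD -[LHS]/(fps_deriv ((f * g) i)) !coeffsM raddf_sum -big_split.
by apply: eq_bigr => k _; exact: fps_derivM.
Qed.
Lemma fps_derivC (c : A) : fps_deriv (fpsC c) = 0.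
Proof. by apply: fpsP => i; rewrite coeffs0 /= mul0rn. Qed.
Lemma dx_cst c : dx (cst c) = 0.
Proof. by apply: fpsP => i; rewrite coeffs0 /= mul0rn. Qed.
Lemma dy_cst c : dy (cst c) = 0.
Proof. by apply: fpsP => -[|i]; rewrite coeffs0 /= ?fps_derivC ?raddf0. Qed.

Definition order_ge N f := forall i j, (i + j < N)%N -> f i j = 0.

Lemma order_ge_eq0 f : (forall N, order_ge N f) -> f = 0.
Proof.
move=> f0; apply: fpsP => i; apply: fpsP => j.
by rewrite (f0 (i + j).+1) // !coeffs0.
Qed.
Lemma order_geW m n f : (m <= n)%N -> order_ge n f -> order_ge m f.
Proof. by move=> mn fn i j ijm; apply: fn; exact: leq_trans mn. Qed.
Lemma order_geD N f g : order_ge N f -> order_ge N g -> order_ge N (f + g).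
Proof. by move=> f0 g0 i j ij; rewrite !coeffsD f0 ?g0 ?addr0. Qed.
Lemma order_geN N f : order_ge N f -> order_ge N (- f).
Proof. by move=> f0 i j ij; rewrite !coeffsN f0 ?oppr0. Qed.
Lemma order_geM m n f g :
  order_ge m f -> order_ge n g -> order_ge (m + n) (f * g).
Proof.
move=> fm gn i j ij; rewrite coeffsM coeffs_sum big1 // => k _.
rewrite coeffsM big1 // => l _.
have [kl|kl] := ltnP (k + l) m; first by rewrite fm ?mul0r.
rewrite gn ?mulr0 //.
have ki : (k <= i)%N by rewrite -ltnS.
have lj : (l <= j)%N by rewrite -ltnS.
by rewrite -(ltn_add2l m) (leq_ltn_trans _ ij) // (leq_trans (leq_add kl (leqnn _)))
  // addnACA !subnKC.
Qed.
Lemma order_geMr N f g : order_ge N f -> order_ge N (f * g).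
Proof. by move=> fN; rewrite -[N]addn0; apply: order_geM. Qed.
Lemma order_geMl N f g : order_ge N f -> order_ge N (g * f).
Proof. by rewrite mulrC; exact: order_geMr. Qed.
Lemma order_ge_sum N n (F : 'I_n -> hatO) :
  (forall i, order_ge N (F i)) -> order_ge N (\sum_i F i).
Proof.
move=> FN; elim/big_ind: _ => //; first by move=> i j _; rewrite !coeffs0.
by move=> f g; exact: order_geD.
Qed.
Lemma order_ge_dx N f : order_ge N.+1 f -> order_ge N (dx f).
Proof. by move=> fN i j ij; rewrite /= coeffsMn fN ?mul0rn. Qed.
Lemma order_ge_dy N f : order_ge N.+1 f -> order_ge N (dy f).
Proof. by move=> fN i j ij; rewrite /= fN ?mul0rn // addnS. Qed.

Lemma cstM c f i j : (cst c * f) i j = c * f i j.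
Proof.
rewrite coeffsM big_ord_recl big1 ?addr0 => [|k _]; last by rewrite /= mul0r.
rewrite subn0 coeffsM big_ord_recl big1 ?addr0 ?subn0 // => k _.
by rewrite /= mul0r.
Qed.

Section Substitution.
Variables (h : hatO) (h00 : h 0%N 0%N = 0).

(* h^k only has terms of total degree >= k when h has no constant term, so the
   coefficient of x^i y^j in \sum_k phi_k h^k only involves the k <= i + j. *)
Definition fps_subst of h 0%N 0%N = 0 := fun phi =>
  Fps (fun i => Fps (fun j => \sum_(k < (i + j).+1) phi k * (h ^+ k) i j)).
Local Notation sub := (fps_subst h00).
Local Notation ev p := (map_poly cst p).[h].

Lemma order_ge_exp k : order_ge k (h ^+ k).
Proof.
elim: k => [//|k IH]; rewrite exprS -add1n; apply: order_geM => //.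
by move=> [|i] [|j].
Qed.

Lemma evE n p : (size p <= n)%N -> ev p = \sum_(k < n) cst p`_k * h ^+ k.
Proof.
move=> sp; rewrite (@horner_coef_wide _ n).
  by apply: eq_bigr => k _; rewrite coef_map.
exact: leq_trans (size_poly _ _) sp.
Qed.

Lemma order_ge_ev N p : (forall k, (k < N)%N -> p`_k = 0) -> order_ge N (ev p).
Proof.
move=> p0; rewrite (evE (leqnn _)); apply: order_ge_sum => k.
have [kN|kN] := ltnP k N; last exact/order_geMl/(order_geW kN)/order_ge_exp.
by rewrite p0 // rmorph0 mul0r => i j _; rewrite !coeffs0.
Qed.

Lemma order_ge_subst N phi : order_ge N.+1 (sub phi - ev (truncation N phi)).
Proof.
move=> i j ijN; rewrite !coeffsD !coeffsN; apply/eqP; rewrite subr_eq0; apply/eqP.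
rewrite (@evE N.+1) ?size_poly // !coeffs_sum /=.
rewrite (big_ord_widen N.+1 (fun k => phi k * (h ^+ k) i j)) // big_mkcond.
apply: eq_bigr => k _; rewrite cstM coef_truncation; last by rewrite -ltnS.
by case: ltnP => // ijk; rewrite (order_ge_exp ijk) ?mulr0.
Qed.

Fact fps_subst_is_zmod_morphism : zmod_morphism sub.
Proof.
move=> phi psi; apply: fpsP => i; apply: fpsP => j.
rewrite !coeffsD !coeffsN /= -sumrB; apply: eq_bigr => k _.
by rewrite mulrBl.
Qed.

Fact fps_subst_is_monoid_morphism : monoid_morphism sub.
Proof.
split=> [|phi psi].
  apply: fpsP => i; apply: fpsP => j /=.
  rewrite big_ord_recl big1 ?addr0 /= ?mul1r ?expr0 // => k _.
  by rewrite mul0r.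
apply/eqP; rewrite -subr_eq0; apply/eqP; apply: order_ge_eq0 => N.
apply: (@order_geW _ N.+1) => //.
pose T := @truncation A N.
have -> : sub (phi * psi) - sub phi * sub psi =
    (sub (phi * psi) - ev (T (phi * psi))) + ev (T (phi * psi) - T phi * T psi)
    - ((sub phi - ev (T phi)) * ev (T psi) + sub phi * (sub psi - ev (T psi))).
  by rewrite rmorphB rmorphM /= hornerD hornerN hornerM; ring.
apply: order_geD; first apply: order_geD.
- exact: order_ge_subst.
- apply: order_ge_ev => k kN; rewrite coefB coef_truncation //.
  by rewrite [X in X - _](@fps_mulE _ _ N) // subrr.
apply: order_geN; apply: order_geD.
- exact/order_geMr/order_ge_subst.
- exact/order_geMl/order_ge_subst.
Qed.

HB.instance Definition _ :=
  GRing.isZmodMorphism.Build (fps A) hatO sub fps_subst_is_zmod_morphism.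
HB.instance Definition _ :=
  GRing.isMonoidMorphism.Build (fps A) hatO sub fps_subst_is_monoid_morphism.

Section ChainRule.
Variable D : {additive hatO -> hatO}.
Hypothesis DM : forall f g, D (f * g) = D f * g + f * D g.
Hypothesis Dcst : forall c, D (cst c) = 0.
Hypothesis orderD : forall N f, order_ge N.+1 f -> order_ge N (D f).

Lemma deriv_ev p : D (ev p) = ev p^`() * D h.
Proof.
elim/poly_ind: p => [|p c IH]; first by rewrite deriv0 !rmorph0 !horner0 raddf0 mul0r.
rewrite derivD derivC addr0 derivM derivX mulr1.
rewrite !rmorphD !rmorphM /= map_polyX map_polyC !hornerE raddfD DM /= Dcst addr0 IH.
ring.
Qed.

Lemma deriv_subst phi : D (sub phi) = sub (fps_deriv phi) * D h.
Proof.
apply/eqP; rewrite -subr_eq0; apply/eqP; apply: order_ge_eq0 => N.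
pose T := @truncation A.
have TD : (T N.+1 phi)^`() = T N (fps_deriv phi).
  apply/polyP => i; rewrite coef_deriv !coef_poly !ltnS.
  by case: ifP => //; rewrite mul0rn.
have -> : D (sub phi) - sub (fps_deriv phi) * D h =
    D (sub phi - ev (T N.+1 phi))
    - (sub (fps_deriv phi) - ev (T N (fps_deriv phi))) * D h.
  by rewrite raddfB deriv_ev TD; ring.
apply: order_geD; first by apply/orderD/(order_geW _ (order_ge_subst _)).
by apply/order_geN/order_geMr/(order_geW _ (order_ge_subst _)).
Qed.
End ChainRule.

Lemma dx_subst phi : dx (sub phi) = sub (fps_deriv phi) * dx h.
Proof. exact: (deriv_subst dxM dx_cst order_ge_dx). Qed.
Lemma dy_subst phi : dy (sub phi) = sub (fps_deriv phi) * dy h.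
Proof. exact: (deriv_subst dyM dy_cst order_ge_dy). Qed.
End Substitution.
End Bivariate.

Lemma exact_comb (A : comPzRingType) (p q u f F F' g g' o : A) :
  p * (F + g * o) + (F' + g' * o) =
  q * u * f + p * F + F' + ((p * g + g') * o - f * q * u).
Proof. by ring. Qed.

Lemma bracket_comb (A : comPzRingType) (p u u' a a' f f' x : A) :
  p * (u - a + f * x) + (u' - a' + f' * x) =
  p * u + u' - (p * a + a') + (p * f + f') * x.
Proof. by ring. Qed.

(* Identities in an abstract field, for use in a field of fractions. *)
Section FieldIdentities.
Variable F : fieldType.
Implicit Types a b c d e h m n p u v w : F.
Lemma quotient_ruleD n m d e (dn dm dd de : F) : d != 0 -> e != 0 ->
  ((dn * e + n * de + (dm * d + m * dd)) * (d * e)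
     - (n * e + m * d) * (dd * e + d * de)) / (d * e) ^+ 2
  = (dn * d - n * dd) / d ^+ 2 + (dm * e - m * de) / e ^+ 2.
Proof. by move=> d0 e0; field; rewrite d0 e0. Qed.
Lemma quotient_ruleM n m d e (dn dm dd de : F) : d != 0 -> e != 0 ->
  ((dn * m + n * dm) * (d * e) - (n * m) * (dd * e + d * de)) / (d * e) ^+ 2
  = (dn * d - n * dd) / d ^+ 2 * (m / e) + n / d * ((dm * e - m * de) / e ^+ 2).
Proof. by move=> d0 e0; field; rewrite d0 e0. Qed.
Lemma mul_scaleD h p w v : h * (p * w + v) = p * (h * w) + h * v.
Proof. by ring. Qed.
Lemma curl_scaleD h p (px py w1 w2 w1y w2x v1y v2x : F) :
  h * (px * w2 + p * w2x + v2x - (py * w1 + p * w1y + v1y)) =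
  px * (h * w2) - py * (h * w1) + p * (h * (w2x - w1y)) + h * (v2x - v1y).
Proof. by ring. Qed.
Lemma mul_quotient_rule h a b : h != 0 ->
  h * h * (h * (a / h ^+ 2 - b / h ^+ 2)) = h * (a - b).
Proof. by move=> h0; field. Qed.
Lemma comb_quotient h a b c d : a * (c / h) + b * (d / h) = (a * c + b * d) / h.
Proof. by rewrite mulrDl !mulrA. Qed.
Lemma exact_scale h a b c d u : h != 0 -> c * d = 1 ->
  (a - b * h * c) * (d * u / h) = a * (d * u / h) - b * u.
Proof.
by move=> h0 cd; rewrite mulrBl -[X in _ = _ - b * X]mul1r -cd; congr (_ - _); field.
Qed.
End FieldIdentities.

Section FractionDerivation.
Variables (O : idomainType) (D : O -> O).
Local Notation K := {fraction O}.
Local Notation "f %:F" := (@tofrac O f).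

(* The quotient rule, on a chosen representative of the fraction. *)
Definition frac_deriv (F : K) : K :=
  (D \n_(repr F) * \d_(repr F) - \n_(repr F) * D \d_(repr F))%:F
    / (\d_(repr F) ^+ 2)%:F.

Lemma frac_repr (F : K) : F = (\n_(repr F))%:F / (\d_(repr F))%:F.
Proof.
have d0 : (\d_(repr F))%:F != 0 by rewrite tofrac_eq0 denom_ratioP.
apply/eqP; rewrite -(inj_eq (mulIf d0)) divfK //; apply/eqP.
rewrite -[F in F * _]reprK; move: (repr F) (denom_ratioP (repr F)) => r r0.
unlock FracField.tofrac; rewrite -[LHS]FracField.pi_mul.
apply/eqmodP; rewrite /= /FracField.equivf /FracField.mulf.
by rewrite !numden_Ratio ?oner_neq0 ?mulr1 // mulrC.
Qed.

Lemma fracE (F : K) : exists n d : O, d != 0 /\ F = n%:F / d%:F.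
Proof.
by exists \n_(repr F), \d_(repr F); split; [exact: denom_ratioP|exact: frac_repr].
Qed.

Hypothesis DB : zmod_morphism D.
Hypothesis DM : forall f g, D (f * g) = D f * g + f * D g.
Let DD f g : D (f + g) = D f + D g.
Proof.
have D0 : D 0 = 0 by rewrite -[X in D X](subrr 0) DB subrr.
have DN k : D (- k) = - D k by rewrite -[X in D X]sub0r DB D0 sub0r.
by rewrite -[g in LHS]opprK DB DN opprK.
Qed.

Lemma frac_derivE n d : d != 0 ->
  frac_deriv (n%:F / d%:F) = (D n * d - n * D d)%:F / (d ^+ 2)%:F.
Proof.
move=> d0; rewrite /frac_deriv; set F := n%:F / d%:F.
have e0 := denom_ratioP (repr F).
have := frac_repr F.
move: e0; rewrite {1}/F; set m := \n_ _; set e := \d_ _ => e0.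
have d0' : d%:F != 0 by rewrite tofrac_eq0.
have e0' : e%:F != 0 by rewrite tofrac_eq0.
move/eqP; rewrite eqr_div // -!tofracM tofrac_eq => /eqP ne.
apply/eqP; rewrite eqr_div ?tofrac_eq0 ?expf_neq0 // -!tofracM tofrac_eq.
have := congr1 D ne; rewrite !DM => nd.
have [E1 E2] : D m * d = D n * e + n * D e - m * D d /\ m * d = n * e.
  by rewrite nd ne; split=> //; rewrite addrK.
apply/eqP.
have -> : (D m * e - m * D e) * d ^+ 2 =
    (D m * d) * (e * d) - (m * d) * D e * d by ring.
have -> : (D n * d - n * D d) * e ^+ 2 =
    D n * e * (e * d) - n * e * D d * e by ring.
by rewrite E1 -E2; move: E2 => E2; ring: E2.
Qed.

Lemma frac_derivD F G : frac_deriv (F + G) = frac_deriv F + frac_deriv G.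
Proof.
have [n [d [d0 ->]]] := fracE F; have [m [e [e0 ->]]] := fracE G.
have d0' : d%:F != 0 by rewrite tofrac_eq0.
have e0' : e%:F != 0 by rewrite tofrac_eq0.
rewrite addf_div // -!tofracM -tofracD !frac_derivE ?mulf_neq0 // !(DD, DM).
by rewrite !(tofracXn, tofracB, tofracD, tofracM) quotient_ruleD.
Qed.

Lemma frac_derivM F G :
  frac_deriv (F * G) = frac_deriv F * G + F * frac_deriv G.
Proof.
have [n [d [d0 ->]]] := fracE F; have [m [e [e0 ->]]] := fracE G.
have d0' : d%:F != 0 by rewrite tofrac_eq0.
have e0' : e%:F != 0 by rewrite tofrac_eq0.
rewrite mulf_div -!tofracM !frac_derivE ?mulf_neq0 // !DM.
by rewrite !(tofracXn, tofracB, tofracD, tofracM) quotient_ruleM.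
Qed.

Lemma frac_deriv_tofrac f : frac_deriv f%:F = (D f)%:F.
Proof.
have D1 : D 1 = 0.
  have := DM 1 1; rewrite !mulr1 mul1r => /eqP.
  by rewrite -subr_eq subrr eq_sym => /eqP.
rewrite -[f%:F]divr1 -tofrac1 frac_derivE ?oner_neq0 // D1 mulr0 subr0.
by rewrite mulr1 expr1n tofrac1 divr1.
Qed.

Lemma frac_deriv0 : frac_deriv 0 = 0.
Proof. by rewrite -tofrac0 frac_deriv_tofrac -[X in D X](subrr 0) DB subrr tofrac0. Qed.
End FractionDerivation.

Section PlaneCurves.
Variable R : realType.
Local Notation C := R[i].
Local Notation hatO := (fps (fps C)).
Local Notation K := {fraction hatO}.
Local Notation "f %:F" := (@tofrac hatO f).

(* In {poly {poly C}}, as for the notation p.[x, y] of polyXY, x is the outer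
   variable and y the inner one. *)
Definition series_of_poly (p : {poly {poly C}}) : hatO :=
  Fps (fun i => Fps (fun j => p`_i`_j)).

Definition isolated_singularity (h : {poly {poly C}}) : Prop :=
  let hx := h^`() in let hy := map_poly (@deriv C) h in
  [/\ h.[0, 0] = 0, hx.[0, 0] = 0, hy.[0, 0] = 0 &
    exists2 e : C, 0 < e & forall x y : C, `|x| < e -> `|y| < e ->
      hx.[x, y] = 0 -> hy.[x, y] = 0 -> x = 0 /\ y = 0].

(* The pair (a, b) stands for the vector field a d/dx + b d/dy. *)
Definition apply_vf (X : hatO * hatO) (f : hatO) : hatO :=
  X.1 * dx f + X.2 * dy f.
Definition bracket (X Z : hatO * hatO) : hatO * hatO :=
  (apply_vf X Z.1 - apply_vf Z X.1, apply_vf X Z.2 - apply_vf Z X.2).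

Definition euler_vf (p1 p2 : nat) : hatO * hatO :=
  (series_of_poly 'X *+ p1, series_of_poly 'Y *+ p2).

Definition quasi_homogeneous (p1 p2 delta : nat) (h : {poly {poly C}}) : Prop :=
  apply_vf (euler_vf p1 p2) (series_of_poly h) = series_of_poly h *+ delta.

Definition converges (f : hatO) : Prop :=
  exists2 r : R, 0 < r & exists M : R, forall m n : nat,
    \sum_(i < m) \sum_(j < n) `|f i j| * (r ^+ (i + j))%:C <= M%:C.

Definition fseriesC : lmodType C := restr (@cst C) hatO^o.

Definition convergent : {pred fseriesC} := fun f => `[< converges f >].

Fact convergent_closed : submod_closed convergent.
Proof.
split=> [|c f g /asboolP[r r0 [M fM]] /asboolP[s s0 [N gN]]]; apply/asboolP.
  exists 1 => //; exists 0 => m n; rewrite big1 // => i _; rewrite big1 // => j _.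
  by rewrite !coeffs0 normr0 mul0r.
pose t := Num.min r s; have t0 : 0 < t by rewrite lt_min r0 s0.
have [c' c'0 cE] : exists2 c' : R, 0 <= c' & `|c| = c'%:C.
  by exists (Num.sqrt (complex.Re c ^+ 2 + complex.Im c ^+ 2)); rewrite ?sqrtr_ge0 // normc_def.
exists t => //; exists (c' * M + N) => m n.
rewrite rmorphD rmorphM /=.
apply: le_trans (lerD (ler_wpM2l _ (fM m n)) (gN m n)); last by rewrite ler0c.
rewrite mulr_sumr -big_split; apply: ler_sum => i _.
rewrite mulr_sumr -big_split; apply: ler_sum => j _.
set fij := (f : hatO) i j; set gij := (g : hatO) i j.
rewrite [X in `|X| * _ <= _](_ : _ = c * fij + gij); last by rewrite /fij -cstM.
rewrite [leRHS]/=.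
apply: le_trans (ler_wpM2r _ (ler_normD _ _)) _; first by rewrite ler0c exprn_ge0 // ltW.
rewrite mulrDl normrM -cE -mulrA; apply: lerD; do ?apply: ler_wpM2l; rewrite ?mulr_ge0 //;
  by rewrite lecR lerXn2r ?nnegrE ?(ltW t0) ?(ltW r0) ?(ltW s0) // ge_min lexx ?orbT.
Qed.
HB.instance Definition _ := @GRing.isSubmodClosed.Build C
  fseriesC convergent convergent_closed.

Definition convergent_series : lmodType C := submod convergent.

Section Singularity.
Variable h : {poly {poly C}}.
Local Notation hs := (series_of_poly h).

Definition in_jacobian_ideal (f : convergent_series) : Prop :=
  exists u v : convergent_series,
    (val f : hatO) = (val u : hatO) * dx hs + (val v : hatO) * dy hs.

Definition jacobian_ideal : {pred convergent_series} :=
  fun f => `[< in_jacobian_ideal f >].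

Fact jacobian_ideal_closed : submod_closed jacobian_ideal.
Proof.
split=> [|c f g /asboolP[u [v fE]] /asboolP[u' [v' gE]]]; apply/asboolP.
  exists 0, 0; rewrite -[val 0]/(0 : hatO) !mul0r addr0.
  by [].
exists (c *: u + u'), (c *: v + v').
have E (w w' : convergent_series) :
  (val (c *: w + w') : hatO) = cst c * (val w : hatO) + (val w' : hatO) by [].
by rewrite !E fE gE; ring.
Qed.
HB.instance Definition _ := @GRing.isSubmodClosed.Build C
  convergent_series jacobian_ideal jacobian_ideal_closed.

Definition milnor_algebra : lmodType C := quomod jacobian_ideal.
Definition milnor_class (f : convergent_series) : milnor_algebra :=
  quoclass jacobian_ideal f.
End Singularity.

Section Logarithmic.
Variables (h : {poly {poly C}}) (hS : isolated_singularity h).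
Variables (delta : nat) (delta_gt0 : (0 < delta)%N).
Local Notation hs := (series_of_poly h).

Fact constant_term_h : hs 0%N 0%N = 0.
Proof. by case: hS => + _ _ _; rewrite /= !horner_coef0. Qed.

Lemma hs_neq0 : hs != 0.
Proof.
apply/eqP => hs0.
have h0 : h = 0.
  apply/polyP => i; apply/polyP => j.
  have /(congr1 (fun f : hatO => f i j)) := hs0.
  by rewrite !coeffs0 !coef0.
case: hS => _ _ _ [e e0 /(_ (e / 2) 0)].
rewrite h0 deriv0 map_poly0 !horner0 normr0 normrM (gtr0_norm e0) normfV normr_nat.
have e2 : e / 2 < e by rewrite ltr_pdivrMr // mulr_natr mulr2n ltrDl.
case/(_ e2 e0 erefl erefl) => /eqP; rewrite mulf_eq0 invr_eq0 pnatr_eq0 orbF.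
by move/eqP => ez; rewrite ez ltxx in e0.
Qed.

(* phi : C[[h]] acts on formal objects as multiplication by phi(h). *)
Definition at_h := fps_subst constant_term_h.
Definition frac_at_h := (@tofrac hatO \o at_h).
HB.instance Definition _ := GRing.RMorphism.on at_h.
HB.instance Definition _ := GRing.RMorphism.on frac_at_h.

Definition fseries : lmodType (fps C) := restr at_h hatO^o.
Definition vfields : lmodType (fps C) := restr at_h (hatO^o * hatO^o)%type.

(* The pair (A, B) stands for the meromorphic form A dx + B dy. *)
Definition forms1 : lmodType (fps C) := restr frac_at_h (K^o * K^o)%type.

Lemma vfieldsE phi (X Z : vfields) : (phi *: X + Z : vfields) =
  (at_h phi * (X : hatO * hatO).1 + (Z : hatO * hatO).1,
   at_h phi * (X : hatO * hatO).2 + (Z : hatO * hatO).2) :> hatO * hatO.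
Proof. by []. Qed.
Lemma forms1E phi (w v : forms1) : (phi *: w + v : forms1) =
  ((at_h phi)%:F * (w : K * K).1 + (v : K * K).1,
   (at_h phi)%:F * (w : K * K).2 + (v : K * K).2) :> K * K.
Proof. by []. Qed.

Definition no_poles (F : K) : Prop := exists f : hatO, F = f%:F.

Definition is_log_vf (X : hatO * hatO) : Prop := exists k, apply_vf X hs = k * hs.
Definition log_vf : {pred vfields} := fun X => `[< is_log_vf X >].

(* That h w has no poles already forces the poles of w to lie on S. *)
Definition is_log_form (w : K * K) : Prop :=
  [/\ no_poles (hs%:F * w.1), no_poles (hs%:F * w.2)
    & no_poles (hs%:F * (frac_deriv (@dx C) w.2 - frac_deriv (@dy C) w.1))].
Definition log_form : {pred forms1} := fun w => `[< is_log_form w >].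

Lemma apply_vfB X : zmod_morphism (apply_vf X).
Proof. by move=> f g; rewrite /apply_vf !raddfB /=; ring. Qed.
Lemma apply_vfM X f g : apply_vf X (f * g) = apply_vf X f * g + f * apply_vf X g.
Proof. by rewrite /apply_vf dxM dyM; ring. Qed.

Fact log_vf_closed : submod_closed log_vf.
Proof.
split=> [|phi X Z /asboolP[k Xk] /asboolP[l Zl]]; apply/asboolP.
  by exists 0; rewrite /apply_vf !mul0r addr0.
exists (at_h phi * k + l).
have -> : apply_vf (phi *: X + Z : vfields) hs =
    at_h phi * apply_vf X hs + apply_vf Z hs.
  transitivity (apply_vf (at_h phi * (X : hatO * hatO).1 + (Z : hatO * hatO).1,
    at_h phi * (X : hatO * hatO).2 + (Z : hatO * hatO).2) hs); first by [].
  by rewrite /apply_vf /fst /snd; ring.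
by rewrite Xk Zl; ring.
Qed.
HB.instance Definition _ := @GRing.isSubmodClosed.Build (fps C) vfields
  log_vf log_vf_closed.

Lemma no_polesD F G : no_poles F -> no_poles G -> no_poles (F + G).
Proof. by move=> [f ->] [g ->]; exists (f + g); rewrite tofracD. Qed.
Lemma no_polesM F G : no_poles F -> no_poles G -> no_poles (F * G).
Proof. by move=> [f ->] [g ->]; exists (f * g); rewrite tofracM. Qed.
Lemma no_polesN F : no_poles F -> no_poles (- F).
Proof. by move=> [f ->]; exists (- f); rewrite tofracN. Qed.

Local Notation Dx := (frac_deriv (@dx C)).
Local Notation Dy := (frac_deriv (@dy C)).
Let DxD := frac_derivD (@dx_is_zmod_morphism C) (@dxM C).
Let DyD := frac_derivD (@dy_is_zmod_morphism C) (@dyM C).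
Let DxM := frac_derivM (@dxM C).
Let DyM := frac_derivM (@dyM C).
Let DxF := frac_deriv_tofrac (@dxM C).
Let DyF := frac_deriv_tofrac (@dyM C).

Fact log_form_closed : submod_closed log_form.
Proof.
split=> [|phi w v /asboolP[w1 w2 dw] /asboolP[v1 v2 dv]]; apply/asboolP.
  have np0 : no_poles 0 by exists 0; rewrite tofrac0.
  have E : (0 : forms1) = (0, 0) :> K * K by [].
  rewrite E; split; rewrite ?mulr0 // /fst /snd.
  rewrite (frac_deriv0 (@dx_is_zmod_morphism C) (@dxM C)).
  by rewrite (frac_deriv0 (@dy_is_zmod_morphism C) (@dyM C)) subrr mulr0.
set p := at_h phi.
have E := forms1E phi w v.
have np f : no_poles f%:F by exists f.
split; rewrite E /=.
- rewrite mul_scaleD; exact: (no_polesD (no_polesM (np _) w1) v1).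
- rewrite mul_scaleD; exact: (no_polesD (no_polesM (np _) w2) v2).
rewrite DxD DyD DxM DyM DxF DyF curl_scaleD.
exact: (no_polesD (no_polesD (no_polesD (no_polesM (np _) w2)
  (no_polesN (no_polesM (np _) w1))) (no_polesM (np _) dw)) dv).
Qed.
HB.instance Definition _ := @GRing.isSubmodClosed.Build (fps C) forms1
  log_form log_form_closed.

Definition chi_log : lmodType (fps C) := submod log_vf.
Definition Omega1_log : lmodType (fps C) := submod log_form.

(* The contraction i_X (dx /\ dy / h) of X = a d/dx + b d/dy is
   (a dy - b dx) / h. *)
Definition contraction (X : hatO * hatO) : K * K :=
  (- (X.2%:F / hs%:F), X.1%:F / hs%:F).

Lemma hsF_neq0 : hs%:F != 0. Proof. by rewrite tofrac_eq0 hs_neq0. Qed.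

Fact contraction_log X : is_log_vf X -> is_log_form (contraction X).
Proof.
case=> k Xk; have h0 := hsF_neq0; split => /=.
- by exists (- X.2); rewrite mulrN mulrC divfK // tofracN.
- by exists X.1; rewrite mulrC divfK.
have -> : - (X.2%:F / hs%:F) = (- X.2)%:F / hs%:F by rewrite tofracN mulNr.
rewrite (frac_derivE (@dxM C)) ?hs_neq0 // (frac_derivE (@dyM C)) ?hs_neq0 //.
exists (dx X.1 + dy X.2 - k).
apply: (mulfI (mulf_neq0 h0 h0)).
rewrite tofracXn mul_quotient_rule // -tofracB -!tofracM; congr (_%:F).
rewrite raddfN.
have -> : dx X.1 * hs - X.1 * dx hs - (- dy X.2 * hs - - X.2 * dy hs) =
    hs * (dx X.1 + dy X.2) - apply_vf X hs by rewrite /apply_vf; ring.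
by rewrite Xk; ring.
Qed.

Fact sharp_subproof (X : chi_log) :
  (contraction (val X) : forms1) \in log_form.
Proof. by apply/asboolP/contraction_log/asboolP; case: X. Qed.
Definition sharp (X : chi_log) : Omega1_log :=
  exist (fun w : forms1 => w \in log_form) _ (sharp_subproof X).

Definition X0 : hatO * hatO :=
  (cst delta%:R^-1 * dy hs, - (cst delta%:R^-1 * dx hs)).
Definition omega0 : K * K :=
  ((cst delta%:R^-1 * dx hs)%:F / hs%:F, (cst delta%:R^-1 * dy hs)%:F / hs%:F).

Lemma apply_X0h : apply_vf X0 hs = 0.
Proof. by rewrite /apply_vf /=; ring. Qed.
Lemma apply_X0_at_h phi : apply_vf X0 (at_h phi) = 0.
Proof.
rewrite /apply_vf /at_h dx_subst dy_subst.
set g := fps_subst _ _; transitivity (g * apply_vf X0 hs).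
  by rewrite /apply_vf; ring.
by rewrite apply_X0h mulr0.
Qed.

Lemma apply_X0_lin phi f g :
  apply_vf X0 (at_h phi * f + g) = at_h phi * apply_vf X0 f + apply_vf X0 g.
Proof.
have -> : at_h phi * f + g = at_h phi * f - (- g) by rewrite opprK.
rewrite apply_vfB apply_vfM apply_X0_at_h mul0r add0r.
by congr (_ + _); rewrite /apply_vf !raddfN; ring.
Qed.

(* A_K^1; brackets and multiples of X_0 are again logarithmic, so nothing is
   lost in taking this inside chi_log. *)
Definition in_AK1 (W : chi_log) : Prop :=
  exists (Z : chi_log) (f : hatO),
    (val W : hatO * hatO) = bracket X0 (val Z) + (f * X0.1, f * X0.2).
Definition AK1 : {pred chi_log} := fun W => `[< in_AK1 W >].

Fact AK1_closed : submod_closed AK1.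
Proof.
split=> [|phi W W' /asboolP[Z [f WE]] /asboolP[Z' [f' WE']]]; apply/asboolP.
  have E : (val (0 : chi_log) : hatO * hatO) = (0, 0) by [].
  exists 0, 0; rewrite E /bracket /apply_vf /fst /snd.
  by rewrite !raddf0 !mul0r !mulr0 !addr0 subrr; congr pair; rewrite addr0.
exists (phi *: Z + Z'), (at_h phi * f + f').
have E (V V' : chi_log) : (val (phi *: V + V') : hatO * hatO) =
    (at_h phi * (val V : hatO * hatO).1 + (val V' : hatO * hatO).1,
     at_h phi * (val V : hatO * hatO).2 + (val V' : hatO * hatO).2).
  by rewrite submod_valP; exact: vfieldsE.
rewrite !E WE WE' /bracket.
have D := apply_X0_lin phi.
have D2 a1 a2 b1 b2 g1 : apply_vf (at_h phi * a1 + b1, at_h phi * a2 + b2) g1 =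
    at_h phi * apply_vf (a1, a2) g1 + apply_vf (b1, b2) g1.
  by rewrite /apply_vf /=; ring.
move: (val Z : hatO * hatO) (val Z' : hatO * hatO) => [a1 a2] [b1 b2].
rewrite /fst /snd !D !D2.
congr pair.
  exact: (bracket_comb _ (apply_vf X0 a1) (apply_vf X0 b1)
    (apply_vf (a1, a2) X0.1) (apply_vf (b1, b2) X0.1) f f' X0.1).
exact: (bracket_comb _ (apply_vf X0 a2) (apply_vf X0 b2)
  (apply_vf (a1, a2) X0.2) (apply_vf (b1, b2) X0.2) f f' X0.2).
Qed.
HB.instance Definition _ := @GRing.isSubmodClosed.Build (fps C) chi_log
  AK1 AK1_closed.

Definition GK1 : lmodType (fps C) := quomod AK1.
Definition GK1_class (v : chi_log) : GK1 := quoclass AK1 v.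

Definition in_imX0 (f : hatO) : Prop := exists g, f = apply_vf X0 g.
Definition imX0 : {pred fseries} := fun f => `[< in_imX0 f >].
Fact imX0_closed : submod_closed imX0.
Proof.
split=> [|phi f f' /asboolP[g fE] /asboolP[g' fE']]; apply/asboolP.
  by exists 0; rewrite /apply_vf !raddf0 !mulr0 addr0.
exists (at_h phi * g + g').
by rewrite apply_X0_lin -fE -fE'.
Qed.
HB.instance Definition _ := @GRing.isSubmodClosed.Build (fps C) fseries
  imX0 imX0_closed.
Definition CokerX0 : lmodType (fps C) := quomod imX0.
Definition CokerX0_class (v : fseries) : CokerX0 := quoclass imX0 v.

(* Depends on delta_gt0, without which omega0 is 0 and the set below need not
   be a submodule. *)
Definition in_B1DR of (0 < delta)%N := fun w : Omega1_log =>
  exists f g : hatO,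
    (val w : K * K) = ((dx f)%:F, (dy f)%:F) + (g%:F * omega0.1, g%:F * omega0.2).
Definition B1DR : {pred Omega1_log} := fun w => `[< in_B1DR delta_gt0 w >].

Fact B1DR_closed : submod_closed B1DR.
Proof.
split=> [|phi w w' /asboolP[f [g wE]] /asboolP[f' [g' wE']]]; apply/asboolP.
  have E : (val (0 : Omega1_log) : K * K) = (0, 0) by [].
  by exists 0, 0; rewrite E !raddf0 !mul0r; congr pair; rewrite addr0.
exists (at_h phi * f + f').
exists (at_h phi * g + g' - f * at_h (fps_deriv phi) * hs * cst delta%:R).
have E (V V' : Omega1_log) : (val (phi *: V + V') : K * K) =
    ((at_h phi)%:F * (val V : K * K).1 + (val V' : K * K).1,
     (at_h phi)%:F * (val V : K * K).2 + (val V' : K * K).2).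
  by rewrite submod_valP; exact: forms1E.
have d0 : cst delta%:R * cst delta%:R^-1 = 1 :> hatO.
  by rewrite -rmorphM divff ?rmorph1 // pnatr_eq0 -lt0n.
set p := at_h phi; set q := at_h (fps_deriv phi).
have dxE : dx (p * f + f') = q * dx hs * f + p * dx f + dx f'.
  by rewrite dxD dxM [dx p]dx_subst.
have dyE : dy (p * f + f') = q * dy hs * f + p * dy f + dy f'.
  by rewrite dyD dyM [dy p]dy_subst.
have h0 := hsF_neq0.
have S u : (p * g + g' - f * q * hs * cst delta%:R)%:F *
    ((cst delta%:R^-1 * u)%:F / hs%:F) =
    (p%:F * g%:F + g'%:F) * ((cst delta%:R^-1 * u)%:F / hs%:F) - (f * q * u)%:F.
  by rewrite tofracB !tofracM tofracD tofracM exact_scale // -tofracM d0 tofrac1.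
have tD3 (a b c : hatO) : (a + b + c)%:F = a%:F + b%:F + c%:F.
  by rewrite !tofracD.
have tA u : (q * u * f)%:F = q%:F * u%:F * f%:F by rewrite !tofracM.
have tB u : (p * u)%:F = p%:F * u%:F by rewrite tofracM.
have tC u : (f * q * u)%:F = f%:F * q%:F * u%:F by rewrite !tofracM.
pose G := p * g + g' - f * q * hs * cst delta%:R.
have H1 : p%:F * ((dx f)%:F + g%:F * omega0.1) + ((dx f')%:F + g'%:F * omega0.1)
    = (dx (p * f + f'))%:F + G%:F * omega0.1.
  rewrite (S (dx hs)) dxE tD3 tA tB tC; exact: exact_comb.
have H2 : p%:F * ((dy f)%:F + g%:F * omega0.2) + ((dy f')%:F + g'%:F * omega0.2)
    = (dy (p * f + f'))%:F + G%:F * omega0.2.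
  rewrite (S (dy hs)) dyE tD3 tA tB tC; exact: exact_comb.
rewrite E wE wE'; exact: (f_equal2 pair H1 H2).
Qed.
HB.instance Definition _ := @GRing.isSubmodClosed.Build (fps C) Omega1_log
  B1DR B1DR_closed.
Definition H1DR : lmodType (fps C) := quomod B1DR.
Definition H1DR_class (v : Omega1_log) : H1DR := quoclass B1DR v.

Section Euler.
Variables (p1 p2 : nat) (hq : quasi_homogeneous p1 p2 delta h).

Definition omegaR : K * K := contraction (euler_vf p1 p2).

Definition comb_omega (a b : hatO) : K * K :=
  (a%:F * omega0.1 + b%:F * omegaR.1, a%:F * omega0.2 + b%:F * omegaR.2).

Lemma comb_omegaE a b : comb_omega a b = contraction
  (a * X0.1 + b * (euler_vf p1 p2).1, a * X0.2 + b * (euler_vf p1 p2).2).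
Proof.
rewrite /comb_omega /omegaR /omega0 /contraction /X0.
move: (euler_vf p1 p2) (cst _ * dx hs) (cst _ * dy hs) => [r1 r2] u v.
rewrite /fst /snd; congr pair.
  by rewrite -mulNr -mulNr comb_quotient tofracD !tofracM tofracN opprD !mulrN opprK.
by rewrite comb_quotient tofracD !tofracM.
Qed.

Fact comb_omega_subproof a b : (comb_omega a b : forms1) \in log_form.
Proof.
apply/asboolP; rewrite comb_omegaE; apply: contraction_log.
exists (b * cst delta%:R).
transitivity (a * apply_vf X0 hs + b * apply_vf (euler_vf p1 p2) hs).
  by rewrite /apply_vf /fst /snd; ring.
by rewrite apply_X0h hq mulr0 add0r rmorph_nat -mulr_natl; ring.
Qed.
(* The form a omega_0 + b omega_R, as an element of Omega1_log. *)
Definition log_comb (a b : hatO) : Omega1_log :=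
  exist (fun w : forms1 => w \in log_form) _ (comb_omega_subproof a b).
End Euler.
End Logarithmic.
End PlaneCurves.

Arguments CokerX0_class {R h} hS delta v.

(* Main.v *)
(* Logarithmic fields are freely generated by [X_0] and [R] (Saito).  Since
   [[X_0, R]] is a multiple of [X_0] and [df = R(f) omega_0 - X_0(f) omega_R], the
   coefficient of [R], resp. [omega_R], identifies both quotients with [Coker X_0].

   Saito's freeness is the exactness of the Koszul complex of [(h_x, h_y)].  As
   the Milnor algebra is finite dimensional, powers of [x] are dependent modulo
   the Jacobian ideal J, and taking a weighted homogeneous component puts some
   [x^m], and likewise [y^m], in J with polynomial coefficients.  This gives the
   Koszul exactness, and that a basis of the convergent Milnor algebra is one of
   the formal Milnor algebra.

   Freeness of [Coker X_0] is the Brieskorn lattice argument: the operators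
   [R + d], [d > 0], are invertible on formal series, which yields
   [J = (h) + im X_0] and that [h f] in [im X_0] forces [f] in [im X_0].  A basis
   modulo J is then a basis over C[[h]] by successive division by [h]. *)
From HB Require Import structures.
Require Import Defs.
From mathcomp Require Import all_boot all_order all_algebra.
From mathcomp Require Import polyXY boolp reals complex ring.

Set Implicit Arguments.
Unset Strict Implicit.
Unset Printing Implicit Defensive.

Import Order.TTheory GRing.Theory Num.Theory.
Local Open Scope ring_scope.
Local Open Scope complex_scope.

(** * Bases and linear maps of quotient modules *)

Section QuotientModules.
Variables (A : nzRingType) (V : lmodType A) (S : submodClosed V).

Lemma quoclassZ a v : quoclass S (a *: v) = a *: quoclass S v.
Proof. by rewrite -[RHS]/(quomod_scale a _) quomod_scaleE. Qed.

Lemma quoclass_eq0 v : quoclass S v = 0 <-> v \in S.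
Proof.
rewrite -[0](raddf0 (quoclass S)) -{2}[v]subr0.
by split=> /quoclassP.
Qed.

Lemma quoclass_lin n (c : 'I_n -> A) (e : 'I_n -> V) :
  \sum_i c i *: quoclass S (e i) = quoclass S (\sum_i c i *: e i).
Proof. by rewrite raddf_sum; apply: eq_bigr => i _; rewrite -quoclassZ. Qed.

(** Subtracting two families of coordinates reduces uniqueness to the class 0. In this form a basis
    is tested by membership in [S] alone. *)
Lemma quomod_basisP n (e : 'I_n -> V) :
  is_basis (fun i => quoclass S (e i)) <->
  (forall v, exists c : 'I_n -> A, v - \sum_i c i *: e i \in S) /\
  (forall c : 'I_n -> A, \sum_i c i *: e i \in S -> forall i, c i = 0).
Proof.
split=> [eb|[espan efree] v].
  split=> [v|c cS i].
    have [c [vc _]] := eb (quoclass S v); exists c.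
    by apply/quoclassP; rewrite vc quoclass_lin.
  have [c0 [_ c0uniq]] := eb 0.
  (* Both the zero family and [c] represent the class 0, so both equal [c0]. *)
  have c1 := c0uniq [ffun => 0]; have c2 := c0uniq (finfun c).
  rewrite -[LHS](ffunE c) -c2 ?c1 ?ffunE //.
    by rewrite big1 // => k _; rewrite ffunE scale0r.
  under eq_bigr do rewrite ffunE.
  by rewrite quoclass_lin; apply/esym/quoclass_eq0.
have [w ->] := quoclass_surj v; have [c wc] := espan w.
exists (finfun c); split.
  under eq_bigr do rewrite ffunE.
  by rewrite quoclass_lin; apply/quoclassP.
move=> c'; rewrite quoclass_lin => /quoclassP wc'; apply/ffunP => i.
rewrite ffunE; apply/eqP; rewrite -subr_eq0; apply/eqP.
apply: (efree (fun k => c k - c' k)).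
have -> : \sum_k (c k - c' k) *: e k =
    (-1) *: (w - \sum_k c k *: e k) + (w - \sum_k c' k *: e k).
  under eq_bigr do rewrite scalerBl.
  by rewrite sumrB scaleN1r opprB addrA subrK.
by rewrite rpredD ?rpredZ.
Qed.

End QuotientModules.

Section QuotientMap.
Variables (A : nzRingType) (V W : lmodType A).
Variables (S : submodClosed V) (T : submodClosed W).
Variable f : {linear V -> W}.

Definition quomap (c : quomod S) : quomod T := quoclass T (f (repr c)).

Hypothesis fS : forall v, (f v \in T) = (v \in S).

Lemma quomapE v : quomap (quoclass S v) = quoclass T (f v).
Proof.
apply/quoclassP; rewrite -raddfB fS.
by apply/quoclassP; rewrite /quoclass reprK.
Qed.

Lemma quomap_linear : linear quomap.
Proof.
move=> a c d; have [v ->] := quoclass_surj c; have [w ->] := quoclass_surj d.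
by rewrite -quoclassZ -raddfD !quomapE linearP raddfD /= -quoclassZ.
Qed.

(** One direction of [fS] makes [quomap] independent of representatives, the other makes it
    injective; the inverse is chosen from surjectivity modulo [T]. *)
Lemma quotient_isomorphism : (forall w, exists v, w - f v \in T) ->
  exists2 Phi : {linear quomod S -> quomod T}, bijective Phi &
    forall v, Phi (quoclass S v) = quoclass T (f v).
Proof.
move=> fsurj.
pose lin := GRing.isLinear.Build A (quomod S) (quomod T) *:%R quomap quomap_linear.
pose Phi : {linear quomod S -> quomod T} := HB.pack quomap lin.
exists Phi; last exact: quomapE.
have surj c : exists d, quomap d = c.
  have [w ->] := quoclass_surj c; have [v wv] := fsurj w.
  by exists (quoclass S v); rewrite quomapE; apply/esym/quoclassP.
have inj : injective quomap.
  move=> c d; have [v ->] := quoclass_surj c; have [w ->] := quoclass_surj d.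
  rewrite !quomapE => /quoclassP; rewrite -raddfB fS => vw.
  exact/quoclassP.
have inv c : quomap (projT1 (cid (surj c))) = c := projT2 (cid (surj c)).
by exists (fun c => projT1 (cid (surj c))) => c; [exact/inj/inv | exact: inv].
Qed.
End QuotientMap.

(* A relation [u f + v g = 0] multiplied by [x] and [y] exhibits [g] as a
   divisor of [x u] and [y u]. *)
Lemma koszul_exact (A : idomainType) (x y f g p q p' q' u v : A) :
  x = p * f + q * g -> y = p' * f + q' * g ->
  (forall P Q, x * Q = y * P -> exists a, P = x * a) ->
  x != 0 -> f \isn't a GRing.unit ->
  u * f + v * g = 0 -> exists a, u = a * g /\ v = - (a * f).
Proof.
move=> xE yE xy x0 fu uv0.
(* If [g = 0], then x = p f and y = p' f give x p' = y p; hence x divides p and f is a unit, against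
   [fu]. *)
have [g0|g0] := eqVneq g 0.
  have f0 : f != 0 by apply: contra_neq x0 => f0; rewrite xE g0 f0 !mulr0 addr0.
  have [|a pE] := xy p p'; first by apply: (mulIf f0); rewrite xE yE g0; ring.
  case/negP: fu; apply/unitrP; exists a.
  have af : a * f = 1.
    by apply: (mulfI x0); rewrite mulrA -pE mulr1 xE g0 mulr0 addr0.
  by split; rewrite // mulrC.
have xu : x * u = g * (q * u - p * v).
  have -> : x * u = p * (u * f + v * g) + g * (q * u - p * v) by rewrite xE; ring.
  by rewrite uv0 mulr0 add0r.
have yu : y * u = g * (q' * u - p' * v).
  have -> : y * u = p' * (u * f + v * g) + g * (q' * u - p' * v) by rewrite yE; ring.
  by rewrite uv0 mulr0 add0r.
have [|a aE] := xy (q * u - p * v) (q' * u - p' * v).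
  by apply: (mulfI g0); rewrite mulrCA -yu [RHS]mulrCA -xu; exact: mulrCA.
have uE : u = a * g by apply: (mulfI x0); rewrite xu aE; ring.
exists a; split=> //; apply: (mulIf g0); apply/eqP.
by rewrite -subr_eq0 -uv0 uE; apply/eqP; ring.
Qed.

(** * Bivariate power series: coefficients, monomials, closed forms *)

Section Series.
Variable R : realType.
Local Notation C := R[i].
Local Notation hatO := (fps (fps C)).
Implicit Types f g u v P Q : hatO.

Lemma fps2P f g : (forall i j, f i j = g i j) -> f = g.
Proof. by move=> fg; apply: fpsP => i; apply: fpsP => j. Qed.

Lemma coeffs2M f g i j :
  (f * g) i j = \sum_(k < i.+1) \sum_(l < j.+1) f k l * g (i - k)%N (j - l)%N.
Proof. by rewrite coeffsM coeffs_sum. Qed.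

Lemma coeffs2D f g i j : (f + g) i j = f i j + g i j. Proof. by []. Qed.
Lemma coeffs2N f i j : (- f) i j = - f i j. Proof. by []. Qed.
Lemma coeffs2Mn f n i j : (f *+ n) i j = f i j *+ n.
Proof. by rewrite !coeffsMn. Qed.

Lemma dxE f i j : dx f i j = f i.+1 j *+ i.+1.
Proof. exact: coeffsMn. Qed.

Lemma dyE f i j : dy f i j = f i j.+1 *+ j.+1.
Proof. by []. Qed.

Lemma dx_dy f : dx (dy f) = dy (dx f).
Proof. by apply: fps2P => i j; rewrite dxE !dyE dxE -!mulrnA mulnC. Qed.

Definition mono (a b : nat) : hatO :=
  Fps (fun i => Fps (fun j => ((i == a) && (j == b))%:R)).

Lemma monoE a b i j : mono a b i j = ((i == a) && (j == b))%:R.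
Proof. by []. Qed.

Lemma monoM a b f i j : (mono a b * f) i j =
  if (a <= i)%N && (b <= j)%N then f (i - a)%N (j - b)%N else 0.
Proof.
rewrite coeffs2M; case: ifP => [/andP[ai bj]|abij].
  rewrite (bigD1 (Ordinal (ai : (a < i.+1)%N))) //= [X in _ + X]big1 ?addr0.
    rewrite (bigD1 (Ordinal (bj : (b < j.+1)%N))) //= !eqxx mul1r big1 ?addr0 //.
    by move=> l lb; rewrite -[(l : nat) == b]/(l == Ordinal (bj : (b < j.+1)%N))
      (negPf lb) mul0r.
  move=> k ka; rewrite big1 // => l _.
  by rewrite -[(k : nat) == a]/(k == Ordinal (ai : (a < i.+1)%N)) (negPf ka) mul0r.
rewrite big1 // => k _; rewrite big1 // => l _ /=.
case: eqP => [ka|]; case: eqP => [lb|] //=; rewrite ?mul0r //.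
by move: abij; rewrite -ka -lb (leq_ord k) (leq_ord l).
Qed.

Lemma series_of_polyX : series_of_poly 'X = mono 1 0 :> hatO.
Proof.
by apply: fps2P => i j; rewrite /= coefX; case: (i == 1%N); rewrite ?coef1 ?coef0.
Qed.

Lemma series_of_polyY : series_of_poly 'Y = mono 0 1 :> hatO.
Proof.
by apply: fps2P => i j; rewrite /= coefC; case: (i == 0%N); rewrite ?coefX ?coef0.
Qed.

(** The left side has no term with x-exponent below m, so neither has P. This is the coprimality of
    x^m and y^m that [koszul_exact] asks for. *)
Lemma mono_dvd m P Q :
  mono m 0 * Q = mono 0 m * P -> exists a, P = mono m 0 * a.
Proof.
move=> PQ; exists (Fps (fun i => Fps (fun j => P (i + m)%N j))).
apply: fps2P => i j; rewrite monoM subn0 andbT /=.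
case: leqP => [mi|im]; first by rewrite subnK.
have := congr1 (fun f : hatO => f i (j + m)%N) PQ; rewrite /= !monoM.
by rewrite leqNgt im /= leq_addl addnK subn0.
Qed.

Lemma poincare u v : dy u = dx v -> exists g, dx g = u /\ dy g = v.
Proof.
move=> uv.
(* Integrate [u] in x; the terms free of x come from integrating v(0, y) in y. *)
exists (Fps (fun i => Fps (fun j =>
  if i is i'.+1 then u i' j / i'.+1%:R
  else if j is j'.+1 then v 0%N j' / j'.+1%:R else 0))).
have nz n : (n.+1%:R : C) != 0 by rewrite pnatr_eq0.
split; apply: fps2P => i j; rewrite ?dxE ?dyE /=.
  by rewrite -[LHS]mulr_natr divfK.
case: i => [|i]; rewrite -[LHS]mulr_natr ?divfK //.
have uvij : u i j.+1 *+ j.+1 = v i.+1 j *+ i.+1 by rewrite -dxE -uv.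
by rewrite mulrAC mulr_natr uvij -[v _ _ *+ _]mulr_natr mulfK.
Qed.

(** * The Euler field and weighted homogeneity *)

Section Weights.
Variables p1 p2 : nat.
Local Notation eu := (apply_vf (euler_vf R p1 p2)).

Lemma eulerE f i j : eu f i j = (p1 * i + p2 * j)%:R * f i j.
Proof.
have -> : eu f = (mono 1 0 * dx f) *+ p1 + (mono 0 1 * dy f) *+ p2.
  by rewrite /apply_vf [(_, _).1]/= [(_, _).2]/= series_of_polyX series_of_polyY !mulrnAl.
rewrite !coeffsD !coeffsMn !monoM dxE dyE !subn0 !andbT natrD mulrDl.
rewrite !natrM -!mulrA !mulr_natl; congr (_ *+ _ + _ *+ _).
  by case: i => [|i]; rewrite ?mulr0n //= subn1.
by case: j => [|j]; rewrite ?mulr0n //= subn1.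
Qed.

Lemma euler_dx f : eu (dx f) = dx (eu f) - dx f *+ p1.
Proof.
apply: fps2P => i j; rewrite eulerE coeffs2D coeffs2N coeffs2Mn !dxE eulerE.
by ring.
Qed.

Lemma euler_dy f : eu (dy f) = dy (eu f) - dy f *+ p2.
Proof.
apply: fps2P => i j; rewrite eulerE coeffs2D coeffs2N coeffs2Mn !dyE eulerE.
by ring.
Qed.

Lemma div_euler f : dx ((euler_vf R p1 p2).1 * f) + dy ((euler_vf R p1 p2).2 * f) =
  eu f + f *+ (p1 + p2).
Proof.
rewrite [(_, _).1]/= [(_, _).2]/= series_of_polyX series_of_polyY !mulrnAl.
apply: fps2P => i j; rewrite coeffs2D [RHS]coeffs2D coeffs2Mn eulerE dxE dyE.
rewrite !coeffs2Mn !monoM /=.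
rewrite !subn0 !subn1 ?andbT; ring.
Qed.

Lemma dx_euler1 : dx (euler_vf R p1 p2).1 = p1%:R.
Proof.
rewrite [(_, _).1]/= series_of_polyX raddfMn /=; congr (_ *+ _).
apply: fps2P => i j; rewrite dxE monoE eqSS.
by case: i => [|i]; [case: j | rewrite mul0rn coeffs0].
Qed.

Lemma dy_euler2 : dy (euler_vf R p1 p2).2 = p2%:R.
Proof.
rewrite [(_, _).2]/= series_of_polyY raddfMn /=; congr (_ *+ _).
apply: fps2P => i j; rewrite dyE monoE eqSS.
by case: i => [|i]; [case: j => [|j] | rewrite mul0rn coeffs0]; rewrite ?mul0rn.
Qed.

Lemma dy_euler1 : dy (euler_vf R p1 p2).1 = 0.
Proof.
rewrite [(_, _).1]/= series_of_polyX raddfMn /= -[RHS](mul0rn _ p1); congr (_ *+ _).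
by apply: fps2P => i j; rewrite dyE monoE andbF mul0rn !coeffs0.
Qed.

Lemma dx_euler2 : dx (euler_vf R p1 p2).2 = 0.
Proof.
rewrite [(_, _).2]/= series_of_polyY raddfMn /= -[RHS](mul0rn _ p2); congr (_ *+ _).
by apply: fps2P => i j; rewrite dxE monoE mul0rn !coeffs0.
Qed.

(** The operator multiplies x^i y^j by p1 i + p2 j + d, which is nonzero because d is positive;
    [euler_inj] holds for the same reason. *)
Lemma euler_surj d f : (0 < d)%N -> exists g, eu g + g *+ d = f.
Proof.
move=> d0; exists (Fps (fun i => Fps (fun j => f i j / (p1 * i + p2 * j + d)%:R))).
apply: fps2P => i j; rewrite coeffs2D coeffs2Mn eulerE /= -[_ *+ d]mulr_natl -mulrDl.
by rewrite -natrD mulrC divfK // pnatr_eq0 -lt0n addn_gt0 d0 orbT.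
Qed.

Lemma euler_inj d f g : (0 < d)%N -> eu f + f *+ d = eu g + g *+ d -> f = g.
Proof.
move=> d0 fg; apply: fps2P => i j.
have : (eu f + f *+ d) i j = (eu g + g *+ d) i j by rewrite fg.
rewrite coeffs2D [in RHS]coeffs2D !coeffs2Mn !eulerE -[f i j *+ d]mulr_natl.
rewrite -[g i j *+ d]mulr_natl -!mulrDl -natrD.
by apply: mulfI; rewrite pnatr_eq0 -lt0n addn_gt0 d0 orbT.
Qed.

Definition whomog (d : nat) f :=
  forall i j, (p1 * i + p2 * j != d)%N -> f i j = 0.

(* The component of weight [d - e], zero if [d < e]. *)
Definition wcomp (d e : nat) f : hatO :=
  Fps (fun i => Fps (fun j => if (p1 * i + p2 * j + e == d)%N then f i j else 0)).

Lemma wcompE d e f i j :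
  wcomp d e f i j = if (p1 * i + p2 * j + e == d)%N then f i j else 0.
Proof. by []. Qed.

(** Weights add under multiplication, so only the part of f of weight d - e contributes. Writing the
    shift additively in [wcomp] makes both sides vanish when d < e. *)
Lemma wcompM d e f g : whomog e g -> wcomp d 0 (f * g) = wcomp d e f * g.
Proof.
move=> ge; apply: fps2P => i j.
transitivity (if (p1 * i + p2 * j == d)%N then (f * g) i j else 0).
  by rewrite -[in RHS](addn0 (_ + _)%N).
rewrite [RHS]coeffs2M [X in if _ then X else _]coeffs2M.
have -> : (if (p1 * i + p2 * j)%N == d then
    \sum_(k < i.+1) \sum_(l < j.+1) f k l * g (i - k)%N (j - l)%N else 0) =
  \sum_(k < i.+1) \sum_(l < j.+1)
    (if (p1 * i + p2 * j)%N == d then f k l else 0) * g (i - k)%N (j - l)%N.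
  by case: eqP => // _; rewrite big1 // => k _; rewrite big1 // => l _; rewrite mul0r.
apply: eq_bigr => k _; apply: eq_bigr => l _ /=.
have [eE|ne] := eqVneq (p1 * (i - k) + p2 * (j - l))%N e; last by rewrite ge ?mulr0.
have ki : (k <= i)%N by rewrite -ltnS.
have lj : (l <= j)%N by rewrite -ltnS.
by rewrite -eE addnACA -!mulnDr !subnKC.
Qed.

Lemma wcompD d e f g : wcomp d e (f + g) = wcomp d e f + wcomp d e g.
Proof. by apply: fps2P => i j; rewrite /=; case: ifP; rewrite ?addr0. Qed.

Lemma euler_whomog d f : eu f = f *+ d -> whomog d f.
Proof.
move=> fd i j ijd; have : eu f i j = (f *+ d) i j by rewrite fd.
rewrite eulerE coeffs2Mn -[_ *+ d]mulr_natl => /eqP.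
by rewrite -subr_eq0 -mulrBl mulf_eq0 subr_eq0 eqr_nat (negPf ijd) => /eqP.
Qed.

(** Truncated subtraction is harmless: if d < p1, no monomial of f involves x and the derivative is
    zero. *)
Lemma whomog_dx d f : whomog d f -> whomog (d - p1) (dx f).
Proof.
move=> fd i j ijd; rewrite dxE fd ?mul0rn //; apply: contra ijd => /eqP <-.
by rewrite mulnS -addnA addKn.
Qed.

Lemma whomog_dy d f : whomog d f -> whomog (d - p2) (dy f).
Proof.
move=> fd i j ijd; rewrite dyE fd ?mul0rn //; apply: contra ijd => /eqP <-.
by rewrite mulnS addnCA addKn.
Qed.

End Weights.
End Series.

(** The coordinates form a matrix with n + 1 rows and n columns, which has a nonzero vector in its
    left kernel. *)
Lemma basis_dependent (F : fieldType) (V : lmodType F) n (e : 'I_n -> V) :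
  is_basis e -> forall b : 'I_n.+1 -> V,
  exists c : 'I_n.+1 -> F, (exists k, c k != 0) /\ \sum_k c k *: b k = 0.
Proof.
move=> eb b; pose co k := projT1 (cid (eb (b k))).
have coE k : b k = \sum_i co k i *: e i := (projT2 (cid (eb (b k)))).1.
pose M := \matrix_(k < n.+1, i < n) co k i.
have : kermx M != 0.
  rewrite -mxrank_eq0 mxrank_ker subn_eq0 -ltnNge ltnS; exact: rank_leq_col.
case/rowV0Pn => v /sub_kermxP vM v0; exists (fun k => v 0 k); split.
  have /existsP[k vk] : [exists k, v 0 k != 0].
    apply: contraNT v0; rewrite negb_exists => /forallP v0.
    apply/eqP/rowP => k; rewrite mxE; apply/eqP; move: (v0 k); by rewrite negbK.
  by exists k.
under eq_bigr do rewrite coE scaler_sumr.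
rewrite exchange_big big1 // => i _.
under eq_bigr do rewrite scalerA.
rewrite -scaler_suml.
have /rowP/(_ i) := vM; rewrite !mxE => vMi.
rewrite -[X in X *: _]/(_) (_ : \sum_i0 _ = 0) ?scale0r // -[RHS]vMi.
by apply: eq_bigr => k _; rewrite mxE.
Qed.

(** * Convergent series: products, shifts, splitting of high-order tails *)

Section Convergence.
Variable R : realType.
Local Notation C := R[i].
Local Notation hatO := (fps (fps C)).
Implicit Types f g u v : hatO.

Lemma geometric_half n : \sum_(i < n) 2^-1 ^+ i <= 2 :> C.
Proof.
have -> : \sum_(i < n) 2^-1 ^+ i = 2 - 2 * 2^-1 ^+ n :> C.
  elim: n => [|n IH]; first by rewrite big_ord0 expr0 mulr1 subrr.
  by rewrite big_ord_recr /= IH exprS; field.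
by rewrite gerBl mulr_ge0 // exprn_ge0 // invr_ge0.
Qed.

(** Terms bounded by M at radius r are summable at radius r / 2, by comparison with two geometric
    series of sum at most 2; whence the bound 4 M. *)
Lemma convergesP f : converges f <->
  exists2 r : R, 0 < r & exists M : R,
    forall i j, `|f i j| * r%:C ^+ (i + j) <= M%:C.
Proof.
split=> -[r r0 [M fM]].
  exists r => //; exists M => i j; apply: le_trans (fM i.+1 j.+1).
  have r0' k : 0 <= (r ^+ k)%:C by rewrite ler0c exprn_ge0 // ltW.
  rewrite (bigD1 ord_max) //= (bigD1 ord_max) //= rmorphXn -addrA lerDl.
  rewrite addr_ge0 // sumr_ge0 // => k _; first by rewrite mulr_ge0.
  by rewrite sumr_ge0 // => l _; rewrite mulr_ge0.
exists (r / 2); first by rewrite divr_gt0.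
exists (M * 4) => m n.
have M0 : 0 <= M%:C by apply: le_trans (fM 0%N 0%N); rewrite mulr_ge0.
apply: (@le_trans _ _ (\sum_(i < m) \sum_(j < n) M%:C * (2^-1 ^+ i * 2^-1 ^+ j))).
  apply: ler_sum => i _; apply: ler_sum => j _.
  rewrite rmorphXn rmorphM fmorphV rmorph_nat exprMn mulrA -exprD.
  by apply: ler_wpM2r (fM i j); rewrite exprn_ge0 // invr_ge0.
under eq_bigr do rewrite -mulr_sumr -mulr_sumr mulrCA.
rewrite -mulr_suml mulrC rmorphM -mulrA ler_wpM2l // rmorph_nat.
rewrite -[4%N]/(2 * 2)%N natrM; apply: ler_pM; last 2 first.
- exact: geometric_half.
- exact: geometric_half.
- by rewrite sumr_ge0 // => i _; rewrite exprn_ge0 // invr_ge0.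
- by rewrite sumr_ge0 // => i _; rewrite exprn_ge0 // invr_ge0.
Qed.

Lemma converges_le (r s M : R) f : 0 < s -> s <= r ->
  (forall i j, `|f i j| * r%:C ^+ (i + j) <= M%:C) ->
  forall i j, `|f i j| * s%:C ^+ (i + j) <= M%:C.
Proof.
move=> s0 sr fM i j; apply: le_trans (fM i j); rewrite ler_wpM2l //.
by rewrite lerXn2r ?nnegrE ?ler0c ?lecR ?(ltW s0) // ltW // (lt_le_trans s0).
Qed.

Lemma convergesM f g : converges f -> converges g -> converges (f * g).
Proof.
move=> /convergesP[r r0 [M fM]] /convergesP[s s0 [N gN]].
pose t := Num.min r s; have t0 : 0 < t by rewrite lt_min r0 s0.
have tr : t <= r by rewrite ge_min lexx.
have ts : t <= s by rewrite ge_min lexx orbT.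
have {}fM := converges_le t0 tr fM.
have {}gN := converges_le t0 ts gN.
(* A coefficient of the product is a sum of (i + 1)(j + 1) terms; halving the radius absorbs this
   factor, since n + 1 <= 2^n. *)
apply/convergesP; exists (t / 2); first by rewrite divr_gt0.
exists (M * N) => i j; rewrite coeffs2M.
have t0' : 0 <= t%:C by rewrite ler0c ltW.
have M0 : 0 <= M%:C by apply: le_trans (fM 0%N 0%N); rewrite mulr_ge0.
have N0 : 0 <= N%:C by apply: le_trans (gN 0%N 0%N); rewrite mulr_ge0.
have bound : `|\sum_(k < i.+1) \sum_(l < j.+1) f k l * g (i - k)%N (j - l)%N|
    * t%:C ^+ (i + j) <= (i.+1%:R * j.+1%:R) * (M * N)%:C.
  have -> : (i.+1%:R * j.+1%:R) * (M * N)%:C =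
      \sum_(k < i.+1) \sum_(l < j.+1) M%:C * N%:C.
    by rewrite !sumr_const !card_ord rmorphM; ring.
  apply: le_trans (ler_wpM2r (exprn_ge0 _ t0') (ler_norm_sum _ _ _)) _.
  rewrite mulr_suml; apply: ler_sum => k _.
  apply: le_trans (ler_wpM2r (exprn_ge0 _ t0') (ler_norm_sum _ _ _)) _.
  rewrite mulr_suml; apply: ler_sum => l _.
  have ki : (k <= i)%N by rewrite -ltnS.
  have lj : (l <= j)%N by rewrite -ltnS.
  have -> : (i + j = (k + l) + ((i - k) + (j - l)))%N by rewrite addnACA !subnKC.
  rewrite normrM exprD mulrACA.
  by apply: ler_pM; rewrite ?mulr_ge0 ?exprn_ge0.
rewrite rmorphM fmorphV rmorph_nat exprMn mulrA.
apply: le_trans (ler_wpM2r _ bound) _; first by rewrite exprn_ge0 // invr_ge0.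
rewrite mulrAC -[leRHS]mul1r ler_wpM2r ?rmorphM ?mulr_ge0 //.
rewrite exprVn ler_pdivrMr ?exprn_gt0 // mul1r exprD -!natrX -!natrM ler_nat.
by rewrite leq_mul // ltn_expl.
Qed.

Lemma convergesD f g : converges f -> converges g -> converges (f + g).
Proof.
move=> cf cg; have [_ /(_ 1 f g)] := convergent_closed R.
move=> /(_ (asboolT cf) (asboolT cg)) /asboolP.
by rewrite scale1r.
Qed.

(** Serves to divide by x^m y^n; the filter [T] lets [order_ge_mono] assign each term to one of two
    summands. *)
Lemma converges_shift m n f (T : nat -> nat -> bool) : converges f ->
  converges (Fps (fun i => Fps (fun j => if T i j then f (i + m)%N (j + n)%N else 0))).
Proof.
move=> /convergesP[r r0 [M fM]]; apply/convergesP; exists r => //.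
have r0' : 0 < r%:C by rewrite ltcR.
have M0 : 0 <= M%:C by apply: le_trans (fM 0%N 0%N); rewrite mulr_ge0 // exprn_ge0 // ltW.
exists (M * (r ^+ (m + n))^-1) => i j /=.
rewrite rmorphM fmorphV rmorphXn ler_pdivlMr ?exprn_gt0 //.
case: ifP => _; last by rewrite normr0 !mul0r.
by rewrite -mulrA -exprD addnACA.
Qed.

Lemma converges_finite N f :
  (forall i j, (N <= i + j)%N -> f i j = 0) -> converges f.
Proof.
move=> f0; apply/convergesP; exists 1 => //.
have nE z : `|z| = (Num.sqrt (complex.Re z ^+ 2 + complex.Im z ^+ 2))%:C :> C.
  by rewrite normc_def.
(* Norms live in C although they are real; [b] extracts the real number needed for a bound in R. *)
pose b (i j : nat) : R := complex.Re `|f i j|.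
have bE i j : `|f i j| = (b i j)%:C by rewrite /b nE.
exists (\sum_(i < N) \sum_(j < N) b i j) => i j.
have -> : (\sum_(i < N) \sum_(j < N) b i j)%:C = \sum_(i < N) \sum_(j < N) `|f i j|.
  rewrite rmorph_sum; apply: eq_bigr => k _.
  by rewrite rmorph_sum; apply: eq_bigr => l _; rewrite bE.
rewrite rmorph1 expr1n mulr1.
have [ijN|/f0 ->] := ltnP (i + j) N; last first.
  by rewrite normr0 sumr_ge0 // => k _; rewrite sumr_ge0.
have iN : (i < N)%N by apply: leq_ltn_trans ijN; apply: leq_addr.
have jN : (j < N)%N by apply: leq_ltn_trans ijN; apply: leq_addl.
rewrite (bigD1 (Ordinal iN)) //= (bigD1 (Ordinal jN)) //= -addrA lerDl.
by rewrite addr_ge0 // sumr_ge0 // => k _; rewrite ?sumr_ge0.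
Qed.

(** With positive weights only finitely many monomials have a given weight, so the component is a
    polynomial. *)
Lemma wcomp_converges p1 p2 d e f : (0 < p1)%N -> (0 < p2)%N ->
  converges (wcomp p1 p2 d e f).
Proof.
move=> p10 p20; apply: (@converges_finite d.+1) => i j ijd /=.
case: eqP => // wd; move: ijd; rewrite -wd ltnNge; case/negP.
rewrite -[(_ + e)%N]addnA leq_add ?leq_pmull //.
by rewrite (leq_trans _ (leq_addr _ _)) // leq_pmull.
Qed.

(** A monomial of degree at least 2m is divisible by x^m or by y^m; those divisible by both go to
    [f1]. *)
Lemma order_ge_mono m f : order_ge (m + m) f ->
  exists f1 f2, f = mono R m 0 * f1 + mono R 0 m * f2 /\
    (converges f -> converges f1 /\ converges f2).
Proof.
move=> fm.
exists (Fps (fun i => Fps (fun j => if true then f (i + m)%N (j + 0)%N else 0))).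
exists (Fps (fun i => Fps (fun j => if (i < m)%N then f (i + 0)%N (j + m)%N else 0))).
split=> [|cf]; last first.
  by split; [exact: (@converges_shift m 0 f (fun _ _ => true))
            |exact: (@converges_shift 0 m f (fun i _ => (i < m)%N))].
apply: fps2P => i j; rewrite !coeffsD !monoM /= !subn0 andbT !addn0.
case: ltnP => im; last by rewrite subnK // if_same addr0.
by case: leqP => jm; rewrite ?subnK ?add0r // fm // -addSn leq_add // ltnW.
Qed.
End Convergence.

(** * From the convergent to the formal Milnor algebra *)

Section MilnorAlgebra.
Variables (R : realType) (h : {poly {poly R[i]}}).
Local Notation C := R[i].
Local Notation hatO := (fps (fps C)).
Local Notation hs := (series_of_poly h).
Implicit Types f g u v : hatO.

Lemma whomog_converges p1 p2 d f : (0 < p1)%N -> (0 < p2)%N ->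
  whomog p1 p2 d f -> converges f.
Proof.
move=> p10 p20 fd; have -> : f = wcomp p1 p2 d 0 f; last exact: wcomp_converges.
apply: fps2P => i j /=; rewrite addn0; case: eqP => // /eqP; exact: fd.
Qed.

Lemma converges_val (f : convergent_series R) : converges (val f : hatO).
Proof. by case: f => f fc; apply/asboolP. Qed.

Definition conv_series u (cu : converges u) : convergent_series R :=
  exist (fun f : fseriesC R => f \in @convergent R) u (asboolT cu).

Lemma jacobian_idealP (f : convergent_series R) :
  f \in jacobian_ideal h <-> exists u v, [/\ converges u, converges v &
    (val f : hatO) = u * dx hs + v * dy hs].
Proof.
split=> [/asboolP[u [v fE]]|[u [v [cu cv fE]]]].
  by exists (val u), (val v); split=> //; exact: converges_val.
by apply/asboolP; exists (conv_series cu), (conv_series cv).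
Qed.

Lemma val_convZ c (f : convergent_series R) :
  (val (c *: f) : hatO) = cst c * (val f : hatO).
Proof.
have : (val (c *: f) : fseriesC R) = c *: (val f : fseriesC R) by exact: linearZ.
exact.
Qed.

Lemma val_convB (f g : convergent_series R) :
  (val (f - g) : hatO) = (val f : hatO) - (val g : hatO).
Proof. exact: (raddfB (val : convergent_series R -> fseriesC R)). Qed.

Lemma val_comb n (c : 'I_n -> C) (a : 'I_n -> convergent_series R) :
  (val (\sum_i c i *: a i) : hatO) = \sum_i cst (c i) * (val (a i) : hatO).
Proof.
rewrite (raddf_sum (val : convergent_series R -> fseriesC R)).
by apply: eq_bigr => i _; exact: val_convZ.
Qed.

Section QuasiHomogeneous.
Variables p1 p2 delta : nat.
Hypotheses (p1_gt0 : (0 < p1)%N) (p2_gt0 : (0 < p2)%N).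
Hypothesis hq : quasi_homogeneous p1 p2 delta h.

(** Since h_x and h_y are weighted homogeneous, taking a component only changes the coefficients,
    which become polynomials even when u and v are merely formal. *)
Lemma wcomp_jacobian d u v : exists u' v', [/\ converges u', converges v' &
  wcomp p1 p2 d 0 (u * dx hs + v * dy hs) = u' * dx hs + v' * dy hs].
Proof.
have hw := euler_whomog hq.
exists (wcomp p1 p2 d (delta - p1) u), (wcomp p1 p2 d (delta - p2) v).
split; rewrite ?wcompD; try exact: wcomp_converges.
by rewrite (wcompM _ _ (whomog_dx hw)) (wcompM _ _ (whomog_dy hw)).
Qed.

Variables (mu : nat) (a : 'I_mu -> convergent_series R).
Hypothesis a_basis : is_basis (fun i => milnor_class h (a i)).

(* Finitely many powers of the monomial are dependent in the Milnor algebra;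
   isolate one of them in the relation by its weight. *)
Lemma mono_power_jacobian s t : (0 < p1 * s + p2 * t)%N ->
  exists m u v, [/\ converges u, converges v &
    mono R (m * s) (m * t) = u * dx hs + v * dy hs].
Proof.
move=> st0.
have cm k : converges (mono R (k * s) (k * t)).
  apply: (@converges_finite _ (k * s + k * t).+1) => i j ij /=.
  by case: eqP => // iE; case: eqP => // jE; rewrite iE jE ltnn in ij.
have [c [[k ck]]] := basis_dependent a_basis
  (fun k : 'I_mu.+1 => milnor_class h (conv_series (cm k))).
rewrite quoclass_lin => /quoclass_eq0/jacobian_idealP[u [v [_ _]]].
rewrite val_comb => E; exists k.
have [u' [v' [cu' cv' E']]] := wcomp_jacobian (p1 * (k * s) + p2 * (k * t)) u v.
have cc z : converges (cst z : hatO).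
  by apply: (@converges_finite _ 1) => -[|i] [|j].
exists (cst (c k)^-1 * u'), (cst (c k)^-1 * v').
split; [exact: convergesM|exact: convergesM|].
rewrite -!mulrA -mulrDr -E' -E; apply: fps2P => i j.
rewrite cstM wcompE addn0 !coeffs_sum.
under eq_bigr do rewrite cstM monoE.
rewrite monoE; case: ifP => [/eqP wE|wne]; last first.
  rewrite mulr0; case: eqP => // iE; case: eqP => // jE.
  by rewrite iE jE eqxx in wne.
(* The monomials in the relation have weights l (p1 s + p2 t), which are pairwise distinct, so only
   the index [k] survives. *)
rewrite (bigD1 k) //= mulrDr mulKf // big1 ?mulr0 ?addr0 // => l lk.
case: eqP => [iE|]; case: eqP => [jE|]; rewrite ?mulr0 //.
case/eqP: lk; apply: val_inj; apply/eqP; move/eqP: wE.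
by rewrite iE jE !(mulnCA p1) !(mulnCA p2) -!mulnDr eqn_pmul2r.
Qed.

Lemma mono_jacobian : exists m u v u' v',
  [/\ converges u, converges v & mono R m 0 = u * dx hs + v * dy hs] /\
  [/\ converges u', converges v' & mono R 0 m = u' * dx hs + v' * dy hs].
Proof.
have [|m [u [v [cu cv xE]]]] := @mono_power_jacobian 1 0.
  by rewrite muln1 muln0 addn0.
have [|n [u' [v' [cu' cv' yE]]]] := @mono_power_jacobian 0 1.
  by rewrite muln1 muln0 add0n.
rewrite muln1 muln0 in xE; rewrite muln1 muln0 in yE.
have cm i j : converges (mono R i j).
  apply: (@converges_finite _ (i + j).+1) => k l kl /=.
  by case: eqP => // kE; case: eqP => // lE; rewrite kE lE ltnn in kl.
(* Multiplying x^m by x^n and y^n by y^m gives a common exponent. *)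
exists (n + m)%N, (mono R n 0 * u), (mono R n 0 * v).
exists (mono R 0 m * u'), (mono R 0 m * v').
split; split; do ?exact: convergesM.
  rewrite -!mulrA -mulrDr -xE; apply: fps2P => i j; rewrite monoM subn0 andbT /=.
  case: leqP => ni; first by rewrite -(eqn_add2l n (i - n)) subnKC.
  by rewrite ltn_eqF // (leq_trans ni) // leq_addr.
rewrite -!mulrA -mulrDr -yE; apply: fps2P => i j; rewrite monoM subn0 /=.
case: leqP => mj; first by rewrite -(eqn_add2r m (j - m)) subnK.
by rewrite (ltn_eqF (leq_trans mj _)) ?andbF // leq_addl.
Qed.

(** This is [koszul_exact] for h_x and h_y with x^m and y^m; h_x vanishes at the origin, so it is
    not a unit. *)
Lemma jacobian_koszul u v : isolated_singularity h ->
  u * dx hs + v * dy hs = 0 -> exists b, u = b * dy hs /\ v = - (b * dx hs).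
Proof.
move=> [_ hx0 _ _].
have [m [p [q [p' [q' [[_ _ xE] [_ _ yE]]]]]]] := mono_jacobian.
apply: (koszul_exact xE yE); first exact: mono_dvd.
  apply/eqP => /(congr1 (fun f : hatO => f m 0%N)); rewrite !coeffs0 /= !eqxx.
  by move/eqP; rewrite oner_eq0.
apply/negP => /unitrP[g [/(congr1 (fun f : hatO => f 0%N 0%N))]].
rewrite coeffs2M !big_ord1 subn0 (_ : dx hs 0%N 0%N = 0) ?mulr0 => [/eqP|].
  by rewrite eq_sym -[X in X == _]/(1 : C) oner_eq0.
by rewrite -hx0 !horner_coef0 coef_deriv dxE coefMn.
Qed.

Lemma truncation_decomp m f : exists t r, [/\ f = t + r, converges t & order_ge m r].
Proof.
pose t : hatO := Fps (fun i => Fps (fun j => if (i + j < m)%N then f i j else 0)).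
exists t, (f - t); split; first by rewrite addrC subrK.
  by apply: (@converges_finite _ m) => i j mij; rewrite /= ltnNge mij.
by move=> i j ijm; rewrite coeffs2D coeffs2N /= ijm subrr.
Qed.

(** Modulo a polynomial, to which the convergent basis applies, f has order at least 2m and so lies
    in the ideal of x^m and y^m, hence in the Jacobian ideal. *)
Lemma formal_milnor_span f : exists (c : 'I_mu -> C) u v,
  f = \sum_i cst (c i) * (val (a i) : hatO) + (u * dx hs + v * dy hs).
Proof.
have [m [p [q [p' [q' [[_ _ xE] [_ _ yE]]]]]]] := mono_jacobian.
have [t [r [-> ct rm]]] := truncation_decomp (m + m) f.
have [r1 [r2 [-> _]]] := order_ge_mono rm.
have [span _] := (quomod_basisP _ _).1 a_basis.
have [c /jacobian_idealP[u [v [_ _ tE]]]] := span (conv_series ct).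
have {}tE : t = \sum_i cst (c i) * (val (a i) : hatO) + (u * dx hs + v * dy hs).
  by rewrite -tE -val_comb val_convB addrC subrK.
exists c, (u + p * r1 + p' * r2), (v + q * r1 + q' * r2).
by rewrite tE xE yE; ring.
Qed.

(** A relation with formal coefficients is made convergent. Truncating u and v leaves a remainder
    that is convergent, as a difference of convergent series, and of order at least 2m; so it lies
    in the convergent Jacobian ideal. *)
Lemma formal_milnor_free (c : 'I_mu -> C) u v :
  \sum_i cst (c i) * (val (a i) : hatO) = u * dx hs + v * dy hs ->
  forall i, c i = 0.
Proof.
have [m [p [q [p' [q' [[cp cq xE] [cp' cq' yE]]]]]]] := mono_jacobian.
have [tu [ru [-> ctu rum]]] := truncation_decomp (m + m) u.
have [tv [rv [-> ctv rvm]]] := truncation_decomp (m + m) v.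
move=> E; have [_] := (quomod_basisP _ _).1 a_basis; apply.
apply/jacobian_idealP; rewrite val_comb.
set s := \sum_i _ in E *.
have cs : converges s by rewrite /s -val_comb; exact: converges_val.
have hw := euler_whomog hq.
have chx := whomog_converges p1_gt0 p2_gt0 (whomog_dx hw).
have chy := whomog_converges p1_gt0 p2_gt0 (whomog_dy hw).
pose r := s + ((- tu) * dx hs + (- tv) * dy hs).
have cN f : converges f -> converges (- f).
  move=> [e e0 [M fM]]; exists e => //; exists M => k l.
  by under eq_bigr do under eq_bigr do rewrite coeffs2N normrN.
have cr : converges r.
  by apply: convergesD => //; apply: convergesD; apply: convergesM => //; exact: cN.
have rm : order_ge (m + m) r.
  have -> : r = ru * dx hs + rv * dy hs by rewrite /r E; ring.
  by apply: order_geD; apply: order_geMr.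
have [r1 [r2 [rE /(_ cr)[cr1 cr2]]]] := order_ge_mono rm.
exists (tu + (p * r1 + p' * r2)), (tv + (q * r1 + q' * r2)).
split; try (do !apply: convergesD => //; exact: convergesM).
have -> : s = r + (tu * dx hs + tv * dy hs) by rewrite /r; ring.
by rewrite rE xE yE; ring.
Qed.
End QuasiHomogeneous.
End MilnorAlgebra.

(** * Freeness of the cokernel of [X0] over C[[h]] *)

Section FormalCokernel.
Variables (R : realType) (h : {poly {poly R[i]}}).
Hypothesis hS : isolated_singularity h.
Variables p1 p2 delta : nat.
Hypotheses (p1_gt0 : (0 < p1)%N) (p2_gt0 : (0 < p2)%N).
Hypothesis delta_gt0 : (0 < delta)%N.
Hypothesis hq : quasi_homogeneous p1 p2 delta h.
Local Notation C := R[i].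
Local Notation hatO := (fps (fps C)).
Local Notation hs := (series_of_poly h).
Local Notation E := (euler_vf R p1 p2).
Local Notation eu := (apply_vf E).
Local Notation dinv := (cst delta%:R^-1 : hatO).
Local Notation X0 := (X0 h delta).
Implicit Types f g u v : hatO.

Lemma dinvK : delta%:R * dinv = 1.
Proof.
rewrite -(rmorph_nat (@cst C)) -rmorphM divff ?rmorph1 // pnatr_eq0 -lt0n //.
Qed.

Lemma dinvMn f : dinv * f *+ delta = f.
Proof. by rewrite -mulr_natl mulrA dinvK mul1r. Qed.

Lemma hsE : hs = dinv * (E.1 * dx hs + E.2 * dy hs).
Proof. by rewrite -[_ + _]/(eu hs) hq mulrnAr dinvMn. Qed.

Lemma X0E f : apply_vf X0 f = dinv * (dy hs * dx f - dx hs * dy f).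
Proof. by rewrite /apply_vf [X0.1]/= [X0.2]/=; ring. Qed.

Lemma dx_dinv f : dx (dinv * f) = dinv * dx f.
Proof. by rewrite dxM dx_cst mul0r add0r. Qed.

Lemma dy_dinv f : dy (dinv * f) = dinv * dy f.
Proof. by rewrite dyM dy_cst mul0r add0r. Qed.

Lemma X0_lin f g : apply_vf X0 (f + g) = apply_vf X0 f + apply_vf X0 g.
Proof. by rewrite !X0E dxD dyD; ring. Qed.

Lemma X0N f : apply_vf X0 (- f) = - apply_vf X0 f.
Proof. by rewrite !X0E !raddfN; ring. Qed.

Lemma X0_hM f : apply_vf X0 (hs * f) = hs * apply_vf X0 f.
Proof. by rewrite apply_vfM apply_X0h mul0r add0r. Qed.

Lemma X0_dinv f : apply_vf X0 (dinv * f) = dinv * apply_vf X0 f.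
Proof. by rewrite !X0E dx_dinv dy_dinv; ring. Qed.

(* With [E f + (p1 + p2) f = div (u, v)], the field [(u, v) - f E] is
   divergence free, hence hamiltonian. *)
Lemma jacobian_X0 u v : exists f g,
  u * dx hs + v * dy hs = hs * f + apply_vf X0 g.
Proof.
have w_gt0 : (0 < p1 + p2)%N by rewrite addn_gt0 p1_gt0.
have [f fE] := @euler_surj R p1 p2 (p1 + p2) (dx u + dy v) w_gt0.
have [|g [gx gy]] := @poincare R (E.2 * f - v) (u - E.1 * f).
  apply/eqP; rewrite !raddfB /= -subr_eq0.
  have D := div_euler p1 p2 f; rewrite fE in D.
  have -> : dy (E.2 * f) - dy v - (dx u - dx (E.1 * f)) =
      dx (E.1 * f) + dy (E.2 * f) - (dx u + dy v) by ring.
  by rewrite D subrr.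
(* The part f E of the field contributes f E(h) = delta h f; the hamiltonian part contributes g_y
   h_x - g_x h_y = - delta X0(g). *)
exists (f *+ delta), (- (g *+ delta)).
rewrite X0E !raddfN !raddfMn /= gx gy.
have -> : u * dx hs + v * dy hs =
    delta%:R * dinv * (u * dx hs + v * dy hs) by rewrite dinvK mul1r.
by rewrite {3}hsE; ring.
Qed.

(** [X0] raises weights by delta - p1 - p2. The form without subtraction intertwines two of the
    invertible operators E + d. *)
Lemma euler_X0 k : eu (apply_vf X0 k) + apply_vf X0 k *+ (p1 + p2) =
  apply_vf X0 (eu k + k *+ delta).
Proof.
have hx : eu (dx hs) = dx hs *+ delta - dx hs *+ p1 by rewrite euler_dx hq raddfMn.
have hy : eu (dy hs) = dy hs *+ delta - dy hs *+ p2 by rewrite euler_dy hq raddfMn.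
have kx := euler_dx p1 p2 k; have ky := euler_dy p1 p2 k.
have euB := apply_vfB E; have euM := apply_vfM E.
have eu_dinv f : eu (dinv * f) = dinv * eu f.
  by rewrite euM {1}/apply_vf dx_cst dy_cst !mulr0 addr0 mul0r add0r.
rewrite !X0E eu_dinv euB !euM hx hy kx ky !raddfD !raddfMn /=; ring.
Qed.

Variables (mu : nat) (a : 'I_mu -> convergent_series R).
Hypothesis a_basis : is_basis (fun i => milnor_class h (a i)).

Let koszul u v : u * dx hs + v * dy hs = 0 ->
  exists b, u = b * dy hs /\ v = - (b * dx hs).
Proof. exact: (jacobian_koszul p1_gt0 p2_gt0 hq a_basis hS). Qed.

(** As E(h) = delta h, the hypothesis says that f E plus a hamiltonian field annihilates h. Koszul
    exactness gives this sum as b (h_y, - h_x), and the divergence recovers f. *)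
Lemma X0_torsion_free f g : hs * f = apply_vf X0 g ->
  exists g', f = apply_vf X0 g'.
Proof.
move=> fg; have [|b [uE vE]] := @koszul (E.1 * f + dy g) (E.2 * f - dx g).
  have -> : (E.1 * f + dy g) * dx hs + (E.2 * f - dx g) * dy hs =
      delta%:R * dinv * ((E.1 * dx hs + E.2 * dy hs) * f + dy g * dx hs - dx g * dy hs).
    by rewrite dinvK; ring.
  have -> : delta%:R * dinv *
        ((E.1 * dx hs + E.2 * dy hs) * f + dy g * dx hs - dx g * dy hs) =
      delta%:R * (dinv * (E.1 * dx hs + E.2 * dy hs) * f - apply_vf X0 g).
    by rewrite X0E; ring.
  by rewrite -hsE fg subrr mulr0.
(* Taking divergences, (E + p1 + p2) f = delta X0(b). With (E + delta) k = delta b, [euler_X0] shows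
   that X0(k) solves the same equation. *)
have [k kE] := @euler_surj R p1 p2 delta (b *+ delta) delta_gt0.
exists k; apply: (@euler_inj R p1 p2 (p1 + p2)); first by rewrite addn_gt0 p1_gt0.
rewrite euler_X0 kE -div_euler X0E !raddfMn /=.
have -> : dinv * (dy hs * (dx b *+ delta) - dx hs * (dy b *+ delta)) =
    delta%:R * dinv * (dy hs * dx b - dx hs * dy b) by ring.
rewrite dinvK mul1r.
have -> : E.1 * f = b * dy hs - dy g by rewrite -uE addrK.
have -> : E.2 * f = dx g - b * dx hs by rewrite -vE addrC subrK.
by rewrite !raddfB /= !dxM !dyM !dx_dy; ring.
Qed.

(** [G n] is the sum of all h^k g(n + k); each coefficient is a finite sum because h^k has order at
    least k. *)
Lemma hs_series (g : nat -> hatO) :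
  exists G : nat -> hatO, forall n, G n = g n + hs * G n.+1.
Proof.
have h00 := constant_term_h hS.
pose G n : hatO := Fps (fun i => Fps (fun j =>
  \sum_(k < (i + j).+1) (hs ^+ k * g (n + k)%N) i j)).
have GE N n : order_ge N (G n - \sum_(k < N) hs ^+ k * g (n + k)%N).
  move=> i j ijN; rewrite coeffs2D coeffs2N !coeffs_sum /=.
  rewrite (big_ord_widen N (fun k => (hs ^+ k * g (n + k)%N) i j)) //.
  rewrite big_mkcond /=; apply/eqP; rewrite subr_eq0; apply/eqP.
  apply: eq_bigr => k _; case: ltnP => // ijk.
  exact/esym/(order_geMr _ (@order_ge_exp _ _ h00 k) ijk).
clearbody G; exists G => n; apply/eqP; rewrite -subr_eq0; apply/eqP.
apply: order_ge_eq0 => N.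
have S1 : \sum_(k < N.+1) hs ^+ k * g (n + k)%N =
    g n + hs * \sum_(k < N) hs ^+ k * g (n.+1 + k)%N.
  rewrite big_ord_recl expr0 mul1r addn0 mulr_sumr; congr (_ + _).
  by apply: eq_bigr => k _; rewrite exprS -mulrA addSnnS.
have -> : G n - (g n + hs * G n.+1) =
    (G n - \sum_(k < N.+1) hs ^+ k * g (n + k)%N)
    - hs * (G n.+1 - \sum_(k < N) hs ^+ k * g (n.+1 + k)%N).
  by rewrite S1; set S := \sum_(k < N) _; ring.
apply: order_geD (order_geW (leqnSn N) (GE N.+1 n)) _.
exact: order_geN (order_geMl _ (GE N n.+1)).
Qed.

(** Iteration makes [e 0] divisible by every h^N, which has order at least N. *)
Lemma hs_separated (e : nat -> hatO) : (forall n, e n = hs * e n.+1) -> e 0%N = 0.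
Proof.
move=> eE; apply: order_ge_eq0 => N; have -> : e 0%N = hs ^+ N * e N.
  by elim: N => [|N IH]; rewrite ?expr0 ?mul1r // IH eE exprSr mulrA.
exact: (order_geMr _ (@order_ge_exp _ _ (constant_term_h hS) N)).
Qed.

Local Notation shift phi := (Fps (fun n => coeffs phi n.+1)).

Lemma at_hC (c : C) : at_h hS (fpsC c) = cst c.
Proof.
apply: fps2P => i j.
rewrite [LHS]/= big_ord_recl big1 ?addr0 => [|k _]; last by rewrite mul0r.
by case: i => [|i]; case: j => [|j]; rewrite /= ?mulr0 ?mulr1.
Qed.

Lemma at_hX : at_h hS (Fps (fun n => (n == 1%N)%:R)) = hs.
Proof.
apply: fps2P => i j; rewrite [LHS]/=; case: (posnP (i + j)) => [/eqP|ij0].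
  rewrite addn_eq0 => /andP[/eqP-> /eqP->].
  by rewrite big_ord1 mul0r (constant_term_h hS).
have ij1 : (1 < (i + j).+1)%N by [].
rewrite (bigD1 (Ordinal ij1)) // expr1 mul1r big1 => [|k k1]; first exact: addr0.
by rewrite -[(k : nat) == 1%N]/(k == Ordinal ij1) (negPf k1) mul0r.
Qed.

Lemma at_hE (phi : fps C) : at_h hS phi = cst (phi 0%N) + hs * at_h hS (shift phi).
Proof.
rewrite -{1}at_hX -at_hC -rmorphM -rmorphD; congr (at_h hS _).
apply: fpsP => n; rewrite coeffsD coeffsM; case: n => [|n] /=.
  by rewrite big_ord1 mul0r addr0.
rewrite big_ord_recl mul0r add0r big_ord_recl /= mul1r subn1 /= big1 ?addr0 ?add0r //.
by move=> k _; rewrite /bump /= mul0r.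
Qed.

Definition cst_comb (c : 'I_mu -> C) : hatO :=
  \sum_i cst (c i) * (val (a i) : hatO).
Definition comb (phi : 'I_mu -> fps C) : hatO :=
  \sum_i at_h hS (phi i) * (val (a i) : hatO).

Lemma comb_at_h (phi : 'I_mu -> fps C) : comb phi =
  cst_comb (fun i => phi i 0%N) + hs * comb (fun i => shift (phi i)).
Proof.
rewrite mulr_sumr -big_split; apply: eq_bigr => i _.
by rewrite {1}at_hE mulrDl mulrA.
Qed.

Lemma cst_comb0 (c : 'I_mu -> C) : (forall i, c i = 0) -> cst_comb c = 0.
Proof. by move=> c0; apply: big1 => i _; rewrite c0 rmorph0 mul0r. Qed.

(* Failing to unify the two sums by unfolding them is prohibitively slow. *)
#[local] Opaque cst_comb comb.

(** The three witnesses are packed in one tuple so that a single choice function can be iterated. *)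
Lemma hadic_step f : exists (s : ('I_mu -> C) * (hatO * hatO)),
  f = cst_comb s.1 + (hs * s.2.1 + apply_vf X0 s.2.2).
Proof.
have [c [u [v ->]]] := formal_milnor_span p1_gt0 p2_gt0 hq a_basis f.
have [f' [g ->]] := jacobian_X0 u v.
by exists (c, (f', g)).
Qed.

Lemma coker_span f : exists (phi : 'I_mu -> fps C) g,
  f = comb phi + apply_vf X0 g.
Proof.
pose st f := projT1 (cid (hadic_step f)).
have stE f0 := projT2 (cid (hadic_step f0)) : f0 = _.
(* [F n] is what remains of f after n divisions by h. *)
pose F n := iter n (fun f => (st f).2.1) f.
rewrite -[f]/(F 0%N).
pose c n := (st (F n)).1; pose g n := (st (F n)).2.2.
have FE n : F n = cst_comb (c n) + (hs * F n.+1 + apply_vf X0 (g n)) by exact: stE.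
clearbody F c g; clear st stE.
have [G GE] := hs_series g.
(* The digits c(n), c(n + 1), ... are the coefficients of [phi n]; all tails are needed to compare
   consecutive stages. *)
have [phi [phi0 phiS]] : exists phi : nat -> 'I_mu -> fps C,
    (forall n, (fun i => phi n i 0%N) = c n) /\
    (forall n, (fun i => shift (phi n i)) = phi n.+1).
  exists (fun n i => Fps (fun k => c (n + k)%N i)); split=> n; apply: funext => i /=.
    by rewrite addn0.
  by apply: fpsP => k /=; rewrite addnS.
have phiE n : comb (phi n) = cst_comb (c n) + hs * comb (phi n.+1).
  by have := comb_at_h (phi n); rewrite phi0 phiS.
exists (phi 0%N), (G 0%N); apply/eqP; rewrite -subr_eq0; apply/eqP.
(* [X0] commutes with multiplication by h, so each error is h times the next one. *)
apply: (@hs_separated (fun n => F n - (comb (phi n) + apply_vf X0 (G n)))) => n.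
by rewrite FE GE X0_lin X0_hM phiE; ring.
Qed.

(** Both h and the image of [X0] lie in the Jacobian ideal, so independence there kills the constant
    terms; torsion freeness then allows division by h. *)
Lemma coker_free_step (phi : 'I_mu -> fps C) g : comb phi = apply_vf X0 g ->
  (forall i, phi i 0%N = 0) /\
  exists g', comb (fun i => shift (phi i)) = apply_vf X0 g'.
Proof.
rewrite comb_at_h; set A := cst_comb _; set B := comb _ => AB.
have phi0 : forall i, phi i 0%N = 0.
  apply: (@formal_milnor_free _ h p1 p2 delta p1_gt0 p2_gt0 hq _ a a_basis _
    (- (dinv * dy g + B * dinv * E.1)) (dinv * dx g - B * dinv * E.2)).
  rewrite -[LHS]/A; have -> : A = apply_vf X0 g - hs * B by rewrite -AB addrK.
  have -> : hs * B = dinv * (E.1 * dx hs + E.2 * dy hs) * B by rewrite -hsE.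
  by rewrite X0E; ring.
split=> //; apply: (@X0_torsion_free _ g); rewrite -AB.
suff -> : A = 0 by rewrite add0r.
exact: cst_comb0.
Qed.

Lemma coker_free (phi : 'I_mu -> fps C) g :
  comb phi = apply_vf X0 g -> forall i, phi i = 0.
Proof.
move=> phig i; apply: fpsP => n; rewrite coeffs0.
elim: n phi g phig => [|n IH] phi g /coker_free_step[phi0 [g' phiS]] //.
exact: (IH (fun i => shift (phi i)) g').
Qed.
End FormalCokernel.

(** Second-order terms cancel since D1 and D2 commute on f. Abstract derivations leave [ring] with
    plain atoms. *)
Lemma derivation_bracket (A : comNzRingType) (D1 D2 : A -> A) (x1 x2 z1 z2 f : A) :
  {morph D1 : u v / u + v} -> {morph D2 : u v / u + v} ->
  (forall u v, D1 (u * v) = D1 u * v + u * D1 v) ->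
  (forall u v, D2 (u * v) = D2 u * v + u * D2 v) -> D1 (D2 f) = D2 (D1 f) ->
  (x1 * D1 z1 + x2 * D2 z1 - (z1 * D1 x1 + z2 * D2 x1)) * D1 f +
  (x1 * D1 z2 + x2 * D2 z2 - (z1 * D1 x2 + z2 * D2 x2)) * D2 f =
  x1 * D1 (z1 * D1 f + z2 * D2 f) + x2 * D2 (z1 * D1 f + z2 * D2 f) -
  (z1 * D1 (x1 * D1 f + x2 * D2 f) + z2 * D2 (x1 * D1 f + x2 * D2 f)).
Proof. by move=> D1D D2D D1M D2M D12; rewrite !D1D !D2D !D1M !D2M D12; ring. Qed.

(** * Logarithmic forms and the coefficient of the Euler form *)

Section LogarithmicForms.
Variables (R : realType) (h : {poly {poly R[i]}}).
Hypothesis hS : isolated_singularity h.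
Variables p1 p2 delta : nat.
Hypotheses (p1_gt0 : (0 < p1)%N) (p2_gt0 : (0 < p2)%N).
Hypothesis delta_gt0 : (0 < delta)%N.
Hypothesis hq : quasi_homogeneous p1 p2 delta h.
Local Notation C := R[i].
Local Notation hatO := (fps (fps C)).
Local Notation K := {fraction hatO}.
Local Notation "f %:F" := (@tofrac hatO f).
Local Notation hs := (series_of_poly h).
Local Notation E := (euler_vf R p1 p2).
Local Notation eu := (apply_vf E).
Local Notation dinv := (cst delta%:R^-1 : hatO).
Local Notation X0 := (X0 h delta).
Implicit Types (f g u v : hatO) (w : Omega1_log hS).

Lemma contraction_inj : injective (contraction h).
Proof.
move=> [x1 x2] [z1 z2] [/oppr_inj xz2 xz1]; have h0 := hsF_neq0 hS.
have inj x z : x%:F / hs%:F = z%:F / hs%:F -> x = z.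
  by move/(mulIf (invr_neq0 h0))/eqP; rewrite tofrac_eq => /eqP.
by rewrite (inj _ _ xz1) (inj _ _ xz2).
Qed.

Lemma contraction_lin p (X Z : hatO * hatO) :
  contraction h (p * X.1 + Z.1, p * X.2 + Z.2) =
  (p%:F * (contraction h X).1 + (contraction h Z).1,
   p%:F * (contraction h X).2 + (contraction h Z).2).
Proof.
rewrite /contraction /=; congr pair.
  by rewrite tofracD tofracM mulrDl opprD mulrN mulrA.
by rewrite tofracD tofracM mulrDl mulrA.
Qed.

Lemma apply_vf_lin p (X Z : hatO * hatO) f :
  apply_vf (p * X.1 + Z.1, p * X.2 + Z.2) f = p * apply_vf X f + apply_vf Z f.
Proof. by rewrite /apply_vf [(_, _).1]/= [(_, _).2]/=; ring. Qed.

Lemma apply_vf_comb p q (X Z : hatO * hatO) f :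
  apply_vf (p * X.1 + q * Z.1, p * X.2 + q * Z.2) f =
  p * apply_vf X f + q * apply_vf Z f.
Proof. by rewrite /apply_vf [(_, _).1]/= [(_, _).2]/=; ring. Qed.

(** For X = (f2, - f1), the quotient rule gives h dw = dx f2 - dy f1 - X(h) / h; absence of poles
    therefore means that h divides X(h). *)
Lemma log_form_contraction (w : K * K) : is_log_form h w ->
  exists X : hatO * hatO, is_log_vf h X /\ w = contraction h X.
Proof.
case: w => w1 w2 [/= [f1 w1E] [f2 w2E] [g gE]]; have h0 := hsF_neq0 hS.
have w1E' : w1 = - ((- f1)%:F / hs%:F).
  by rewrite tofracN mulNr opprK -w1E mulrC mulKf.
have w2E' : w2 = f2%:F / hs%:F by rewrite -w2E mulrC mulKf.
exists (f2, - f1); split; last by rewrite /contraction /= -w1E' -w2E'.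
exists (dx f2 - dy f1 - g).
move: gE; rewrite w2E' w1E' tofracN mulNr opprK.
rewrite (frac_derivE (@dxM C)) ?hs_neq0 // (frac_derivE (@dyM C)) ?hs_neq0 //.
move/(congr1 ( *%R (hs%:F * hs%:F))).
rewrite !tofracXn mul_quotient_rule // -tofracB -!tofracM => /eqP.
rewrite tofrac_eq -!mulrA => /eqP/(mulfI (hs_neq0 hS)) gE.
apply: (mulfI (hs_neq0 hS)); rewrite /apply_vf /=.
have -> : hs * ((dx f2 - dy f1 - g) * hs) = hs * (hs * (dx f2 - dy f1)) - hs * (hs * g).
  by ring.
by rewrite -gE; ring.
Qed.

(* Through [sharp], [b] is the coefficient of [omega_R]. *)
Definition euler_coef (w : Omega1_log hS) (b : hatO) : Prop :=
  exists X : hatO * hatO, (val w : K * K) = contraction h X /\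
    apply_vf X hs = b * (hs *+ delta).

Lemma euler_coef_exists w : exists b, euler_coef w b.
Proof.
have /asboolP/log_form_contraction[X [[k Xk] wX]] : val w \in @log_form R h hS by case: w.
exists (dinv * k), X; split=> //.
by rewrite Xk -{1}(dinvMn delta_gt0 k); ring.
Qed.

Definition omegaR_coef (w : Omega1_log hS) : hatO :=
  projT1 (cid (euler_coef_exists w)).

(** The field X is determined by w, and delta h is nonzero in a domain, so the chosen coefficient is
    the only one. *)
Lemma omegaR_coefP w b : euler_coef w b -> omegaR_coef w = b.
Proof.
rewrite /omegaR_coef; case: cid => b' /= [X [wX Xb']] [Z [wZ Zb]].
have XZ : X = Z by apply: contraction_inj; rewrite -wX.
have hd : hs *+ delta != 0.
  rewrite -mulr_natr mulf_neq0 ?(hs_neq0 hS) //.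
  by apply: contra_eq_neq (dinvK R delta_gt0) => ->; rewrite mul0r eq_sym oner_neq0.
by apply: (mulIf hd); rewrite -Xb' -Zb XZ.
Qed.

Lemma euler_coefP w : euler_coef w (omegaR_coef w).
Proof. exact: projT2 (cid (euler_coef_exists w)). Qed.

Lemma val_Omega1 phi (w v : Omega1_log hS) : (val (phi *: w + v) : K * K) =
  ((at_h hS phi)%:F * (val w : K * K).1 + (val v : K * K).1,
   (at_h hS phi)%:F * (val w : K * K).2 + (val v : K * K).2).
Proof. by rewrite submod_valP; exact: forms1E. Qed.

Lemma val_chi phi (X Z : chi_log hS) : (val (phi *: X + Z) : hatO * hatO) =
  (at_h hS phi * (val X : hatO * hatO).1 + (val Z : hatO * hatO).1,
   at_h hS phi * (val X : hatO * hatO).2 + (val Z : hatO * hatO).2).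
Proof. by rewrite submod_valP; exact: vfieldsE. Qed.

Lemma omegaR_coef_linear : linear (omegaR_coef : Omega1_log hS -> fseries hS).
Proof.
move=> phi w v.
have [X [wX Xb]] := euler_coefP w; have [Z [vZ Zb]] := euler_coefP v.
apply: omegaR_coefP.
exists (at_h hS phi * X.1 + Z.1, at_h hS phi * X.2 + Z.2); split.
  by rewrite val_Omega1 wX vZ contraction_lin.
rewrite apply_vf_lin Xb Zb mulrA -mulrDl; congr (_ * _).
Qed.

Lemma sharp_linear : linear (fun X : chi_log hS => sharp X).
Proof.
move=> phi X Z; apply: val_inj.
apply: etrans (esym (val_Omega1 _ _ _)).
by rewrite -contraction_lin -val_chi.
Qed.

Lemma sharp_surj (w : Omega1_log hS) : exists X, sharp X = w.
Proof.
have /asboolP/log_form_contraction[X [Xl wX]] : val w \in @log_form R h hS by case: w.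
exists (exist (fun X : vfields hS => X \in @log_vf R h hS) X (asboolT Xl)).
by apply: val_inj; rewrite wX.
Qed.

Variables (mu : nat) (a : 'I_mu -> convergent_series R).
Hypothesis a_basis : is_basis (fun i => milnor_class h (a i)).

(** X - b E annihilates h, so it is a multiple of (h_y, - h_x) by Koszul exactness. *)
Lemma saito X b : apply_vf X hs = b * (hs *+ delta) ->
  exists c, X = (c * X0.1 + b * E.1, c * X0.2 + b * E.2).
Proof.
case: X => X1 X2; rewrite -hq => Xb.
have [|c [c1 c2]] := jacobian_koszul p1_gt0 p2_gt0 hq a_basis
  (u := X1 - b * E.1) (v := X2 - b * E.2) hS.
  have -> : (X1 - b * E.1) * dx hs + (X2 - b * E.2) * dy hs =
    apply_vf (X1, X2) hs - b * eu hs by rewrite /apply_vf [(_, _).1]/= [(_, _).2]/=; ring.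
  by rewrite Xb subrr.
exists (delta%:R * c); rewrite /Defs.X0.
have D x : delta%:R * c * (dinv * x) = c * x.
  have -> : delta%:R * c * (dinv * x) = delta%:R * dinv * (c * x) by ring.
  by rewrite dinvK // mul1r.
congr pair; rewrite /= ?mulrN D; first by rewrite -c1 subrK.
by rewrite -c2 subrK.
Qed.

Lemma log_form_comb w : exists c,
  (val w : K * K) = comb_omega h delta p1 p2 c (omegaR_coef w).
Proof.
have [X [wX Xb]] := euler_coefP w; have [c XE] := saito Xb.
by exists c; rewrite wX comb_omegaE XE.
Qed.

Lemma omegaR_coef_comb w u v :
  (val w : K * K) = comb_omega h delta p1 p2 u v -> omegaR_coef w = v.
Proof.
rewrite comb_omegaE => wE; apply: omegaR_coefP.
exists (u * X0.1 + v * E.1, u * X0.2 + v * E.2); split=> //.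
by rewrite apply_vf_comb apply_X0h mulr0 add0r hq.
Qed.

(** After clearing the denominator h, replacing h by E(h) / delta turns each coordinate into a ring
    identity. *)
Lemma exact_form f : ((dx f)%:F, (dy f)%:F) =
  comb_omega h delta p1 p2 (eu f) (- apply_vf X0 f).
Proof.
have h0 := hsF_neq0 hS; have hE := hsE delta_gt0 hq.
rewrite comb_omegaE /contraction.
have X01 : X0.1 = dinv * dy hs by [].
have X02 : X0.2 = - (dinv * dx hs) by [].
have euE : eu f = E.1 * dx f + E.2 * dy f by [].
rewrite X0E X01 X02 euE; move: (euler_vf R p1 p2) hE => [e1 e2].
rewrite /fst /snd => hE.
have xE : (dx f)%:F * hs%:F = (hs * dx f)%:F by rewrite mulrC tofracM.
have yE : (dy f)%:F * hs%:F = (hs * dy f)%:F by rewrite mulrC tofracM.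
congr pair; apply: (mulIf h0); rewrite ?mulNr divfK // ?xE ?yE -?tofracN.
  congr (_%:F).
  have -> : hs * dx f = dinv * (e1 * dx hs + e2 * dy hs) * dx f by rewrite -hE.
  by ring.
congr (_%:F).
  have -> : hs * dy f = dinv * (e1 * dx hs + e2 * dy hs) * dy f by rewrite -hE.
by ring.
Qed.

Lemma omega0_comb g : (g%:F * (omega0 h delta).1, g%:F * (omega0 h delta).2) =
  comb_omega h delta p1 p2 g 0.
Proof. by rewrite /comb_omega tofrac0 !mul0r !addr0. Qed.

Lemma comb_omegaD u v u' v' :
  (comb_omega h delta p1 p2 u v) + (comb_omega h delta p1 p2 u' v') =
  comb_omega h delta p1 p2 (u + u') (v + v').
Proof.
by rewrite /comb_omega /=; congr pair; rewrite !tofracD !mulrDl addrACA.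
Qed.

Lemma B1DR_coef w : (w \in @B1DR R h hS delta delta_gt0) =
  ((omegaR_coef w : fseries hS) \in @imX0 R h hS delta).
Proof.
apply/asboolP/asboolP=> [[f [g wE]]|[f fE]].
  exists (- f); rewrite X0N; apply: (@omegaR_coef_comb w (eu f + g) _).
  by rewrite wE exact_form omega0_comb comb_omegaD addr0.
(* By [exact_form], d(- f) has the required [omegaR] coefficient X0(f); the second witness corrects
   the coefficient of [omega0]. *)
have [c wE] := log_form_comb w; exists (- f), (c - eu (- f)).
rewrite exact_form omega0_comb comb_omegaD wE X0N opprK addr0 addrCA subrr addr0.
by rewrite fE.
Qed.

Lemma bracketE (X Z : hatO * hatO) f :
  apply_vf (bracket X Z) f = apply_vf X (apply_vf Z f) - apply_vf Z (apply_vf X f).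
Proof.
exact: (derivation_bracket _ _ _ _ (@dxD C) (@dyD C) (@dxM C) (@dyM C) (dx_dy f)).
Qed.

Lemma apply_vf_scale (X : hatO * hatO) f g :
  apply_vf (f * X.1, f * X.2) g = f * apply_vf X g.
Proof. by rewrite /apply_vf /fst /snd mulrDr !mulrA. Qed.

Lemma X0_euler1 : apply_vf X0 E.1 = X0.1 *+ p1.
Proof. by rewrite {1}/apply_vf dx_euler1 dy_euler1 mulr0 addr0 mulr_natr. Qed.

Lemma X0_euler2 : apply_vf X0 E.2 = X0.2 *+ p2.
Proof. by rewrite {1}/apply_vf dx_euler2 dy_euler2 mulr0 add0r mulr_natr. Qed.

Lemma euler_dinv f : eu (dinv * f) = dinv * eu f.
Proof. by rewrite apply_vfM {1}/apply_vf dx_cst dy_cst !mulr0 addr0 mul0r add0r. Qed.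

Lemma euler_X01 : eu X0.1 = X0.1 *+ delta - X0.1 *+ p2.
Proof.
rewrite -[X0.1]/(dinv * dy hs) euler_dinv euler_dy hq raddfMn mulrBr.
by rewrite -!mulrnAr.
Qed.

Lemma euler_X02 : eu X0.2 = X0.2 *+ delta - X0.2 *+ p1.
Proof.
have -> : X0.2 = dinv * - dx hs by rewrite mulrN.
have N : eu (- dx hs) = - eu (dx hs).
  by have /(_ 0 (dx hs)) := apply_vfB E; rewrite /apply_vf !raddf0 !mulr0 !add0r.
by rewrite euler_dinv N euler_dx hq raddfMn; ring.
Qed.

(** Leibniz rule, with [X0, E] = (p1 + p2 - delta) X0. *)
Lemma bracket_X0_euler f : exists g, bracket X0 (f * E.1, f * E.2) =
  (apply_vf X0 f * E.1 + g * X0.1, apply_vf X0 f * E.2 + g * X0.2).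
Proof.
exists (f * ((p1 + p2)%:R - delta%:R)); rewrite /bracket !apply_vf_scale.
rewrite euler_X01 euler_X02 -[(f * E.1, f * E.2).1]/(f * E.1).
rewrite -[(f * E.1, f * E.2).2]/(f * E.2) !apply_vfM X0_euler1 X0_euler2.
move: (apply_vf X0 f) E.1 E.2 X0.1 X0.2 => c e1 e2 x1 x2.
by congr pair; ring.
Qed.

Lemma AK1_coef (W : chi_log hS) :
  (W \in @AK1 R h hS delta) =
  ((omegaR_coef (sharp W) : fseries hS) \in @imX0 R h hS delta).
Proof.
have valS : (val (sharp W) : K * K) = contraction h (val W) by [].
apply/asboolP/asboolP=> [[Z [f WE]]|[f fE]].
  have /asboolP[k Zk] : val Z \in @log_vf R h hS by case: Z {WE}.
  (* As X0(h) = 0 and Z(h) = k h, the bracket sends h to X0(k) h; dividing by delta gives the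
     coefficient. *)
  exists (dinv * k); apply: omegaR_coefP; exists (val W); split=> //.
  rewrite WE X0_dinv.
  have -> : apply_vf (bracket X0 (val Z) + (f * X0.1, f * X0.2)) hs =
      apply_vf (bracket X0 (val Z)) hs + f * apply_vf X0 hs.
    by rewrite -apply_vf_scale /apply_vf /=; ring.
  rewrite bracketE apply_X0h mulr0 addr0 Zk apply_vfM apply_X0h mulr0 addr0.
  have -> : apply_vf (val Z) 0 = 0 by rewrite /apply_vf !raddf0 !mulr0 addr0.
  by rewrite subr0 -{1}(dinvMn delta_gt0 (apply_vf X0 k)); ring.
have [X [WX Xb]] := euler_coefP (sharp W).
have {WX} WX : val W = X by apply: contraction_inj; rewrite -valS.
have [c XE] := saito Xb; have [g gE] := bracket_X0_euler f.
have Zl : is_log_vf h (f * E.1, f * E.2).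
  by exists (f *+ delta); rewrite apply_vf_scale hq mulrnAr mulrnAl.
(* W = c X0 + X0(f) E, and the bracket of X0 with f E is X0(f) E + g X0. *)
exists (exist (fun X : vfields hS => X \in @log_vf R h hS) _ (asboolT Zl)), (c - g).
rewrite [val (exist _ _ _)]/= gE WX XE fE; congr pair; rewrite /=; ring.
Qed.

(** Membership in [AK1] and in [B1DR] is the same condition on the Euler coefficient, so [sharp]
    matches the two submodules. *)
Lemma sharp_isomorphism :
  exists2 Phi : {linear GK1 hS delta -> H1DR hS delta_gt0}, bijective Phi &
    forall X, Phi (GK1_class delta X) = H1DR_class delta_gt0 (sharp X).
Proof.
pose lin := GRing.isLinear.Build (fps C) (chi_log hS) (Omega1_log hS) *:%R
  (fun X => sharp X) sharp_linear.
pose f : {linear chi_log hS -> Omega1_log hS} := HB.pack (fun X => sharp X) lin.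
apply: (@quotient_isomorphism _ _ _ _ _ f) => [W|w].
  by rewrite AK1_coef -B1DR_coef.
by have [X <-] := sharp_surj w; exists X; rewrite subrr rpred0.
Qed.

Definition omegaR_coef_lin : {linear Omega1_log hS -> fseries hS} :=
  HB.pack (omegaR_coef : Omega1_log hS -> fseries hS)
    (GRing.isLinear.Build (fps C) (Omega1_log hS) (fseries hS) *:%R _ omegaR_coef_linear).

Lemma omegaR_coefD w (v : Omega1_log hS) :
  omegaR_coef (w + v) = omegaR_coef w + omegaR_coef v.
Proof. exact: (raddfD omegaR_coef_lin). Qed.

Lemma omegaR_coefB w (v : Omega1_log hS) :
  omegaR_coef (w - v) = omegaR_coef w - omegaR_coef v.
Proof. exact: (raddfB omegaR_coef_lin). Qed.

Lemma omegaR_coef0 : omegaR_coef 0 = 0.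
Proof. exact: (raddf0 omegaR_coef_lin). Qed.

Lemma omegaR_coefZ phi w : omegaR_coef (phi *: w) = at_h hS phi * omegaR_coef w.
Proof. exact: (linearZ_LR omegaR_coef_lin). Qed.

Lemma coef_isomorphism :
  exists2 Psi : {linear H1DR hS delta_gt0 -> CokerX0 hS delta}, bijective Psi &
    forall u v,
      Psi (H1DR_class delta_gt0 (log_comb hS hq u v)) = CokerX0_class hS delta v.
Proof.
have coef u v : omegaR_coef (log_comb hS hq u v) = v.
  exact: (@omegaR_coef_comb _ u).
have [||Psi Psib PsiE] := @quotient_isomorphism _ _ _
   (@B1DR R h hS delta delta_gt0) (@imX0 R h hS delta) omegaR_coef_lin.
- by move=> w; rewrite B1DR_coef.
- by move=> v; exists (log_comb hS hq 0 v); rewrite /= coef subrr rpred0.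
by exists Psi => // u v; rewrite PsiE /= coef.
Qed.

(** The coefficient map carries combinations of these forms to [comb], so spanning and independence
    come from [coker_span] and [coker_free]. *)
Lemma omegaR_basis :
  is_basis (fun i => H1DR_class delta_gt0 (log_comb hS hq 0 (val (a i)))).
Proof.
have coef v : omegaR_coef (log_comb hS hq 0 v) = v.
  exact: (@omegaR_coef_comb _ 0).
have coef_sum (c : 'I_mu -> fps C) :
    omegaR_coef (\sum_i c i *: log_comb hS hq 0 (val (a i))) = comb hS a c.
  rewrite (big_morph omegaR_coef omegaR_coefD omegaR_coef0).
  by apply: eq_bigr => i _; rewrite omegaR_coefZ coef.
apply/quomod_basisP; split=> [w|c].
  have [c [g cE]] := coker_span hS p1_gt0 p2_gt0 delta_gt0 hq a_basis (omegaR_coef w).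
  exists c; rewrite B1DR_coef; apply/asboolP; exists g.
  by rewrite omegaR_coefB coef_sum cE addrC addKr.
rewrite B1DR_coef coef_sum => /asboolP[g].
exact: (coker_free p1_gt0 p2_gt0 delta_gt0 hq a_basis).
Qed.
End LogarithmicForms.

Theorem proposition5p1 (R : realType) (p1 p2 delta mu : nat)
  (h : {poly {poly R[i]}})
  (p1_gt0 : (0 < p1)%N) (p2_gt0 : (0 < p2)%N) (p12 : coprime p1 p2)
  (delta_gt0 : (0 < delta)%N)
  (hq : quasi_homogeneous p1 p2 delta h)
  (hS : isolated_singularity h)
  (mu_gt0 : (0 < mu)%N)
  (a : 'I_mu -> convergent_series R)
  (a1 : val (a (Ordinal mu_gt0)) = 1 :> fps (fps R[i]))
  (a_basis : is_basis (fun i => milnor_class h (a i))) :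
  [/\ (exists2 Phi : {linear GK1 hS delta -> H1DR hS delta_gt0},
         bijective Phi &
         forall X : chi_log hS,
           Phi (GK1_class delta X) = H1DR_class delta_gt0 (sharp X)),
      (exists2 Psi : {linear H1DR hS delta_gt0 -> CokerX0 hS delta},
         bijective Psi &
         forall u v : fps (fps R[i]),
           Psi (H1DR_class delta_gt0 (log_comb hS hq u v)) = CokerX0_class hS delta v)
    & is_basis (fun i =>
        H1DR_class delta_gt0 (log_comb hS hq 0 (val (a i))))].
Proof.
split.
- exact: (sharp_isomorphism hS p1_gt0 p2_gt0 delta_gt0 hq a_basis).
- exact: (coef_isomorphism hS p1_gt0 p2_gt0 delta_gt0 hq a_basis).
- exact: (omegaR_basis p1_gt0 p2_gt0 hq a_basis).
Qed.
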